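(* Let $k$ be a finite field of characteristic $p$. Then every complete noetherian local $W(k)$-algebra with residue field $k$ is a universal deformation ring. More precisely, let $A$ be a complete noetherian local $W(k)$-algebra with residue field $k$ and maximal ideal $\mathfrak m_A$, let $n\ge 3$ be an integer, and if $k=\mathbb F_2$ assume in addition that $n\ge 5$. Let $\Gamma:=SL_n(A)$ (with its profinite topology), let $\rho_A:\Gamma\to SL_n(A)\subseteq GL_n(A)$ be the standard (identity) representation, and let $\overline\rho:\Gamma\to GL_n(k)$ be the reduction of $\rho_A$ modulo $\mathfrak m_A$. Then $A$, together with $\rho_A$, is the universal deformation ring for $\Gamma$ and $\overline\rho$; that is, for every complete noetherian local $W(k)$-algebra $B$ with residue field $k$ and every continuous representation $\rho_B:\Gamma\to GL_n(B)$ lifting $\overline\rho$, there is a unique local homomorphism of $W(k)$-algebras $\pi:A\to B$ such that $\pi\circ\rho_A$ is strictly equivalent to $\rho_B$.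
   Context: $W(k)$ denotes the ring of Witt vectors of $k$. A cnl-ring is a complete noetherian local $W(k)$-algebra with residue field $k$; morphisms of cnl-rings are local homomorphisms of $W(k)$-algebras. Let $\Gamma$ be a topologically finitely generated profinite group and $\overline\rho:\Gamma\to GL_n(k)$ a continuous absolutely irreducible representation. For a cnl-ring $B$ with maximal ideal $\mathfrak m_B$, a continuous representation $\rho_B:\Gamma\to GL_n(B)$ lifts $\overline\rho$ if $\rho_B \bmod \mathfrak m_B=\overline\rho$. Two lifts to $GL_n(B)$ are strictly equivalent if they are conjugate by a matrix in $\ker(GL_n(B)\to GL_n(k))$. A cnl-ring $R$ together with a lift $\rho_R:\Gamma\to GL_n(R)$ of $\overline\rho$ is the universal deformation ring for $\Gamma,\overline\rho$ if for every cnl-ring $B$ and every lift $\rho_B$ of $\overline\rho$ to $GL_n(B)$ there is a unique morphism of cnl-rings $\pi:R\to B$ such that $\pi\circ\rho_R$ is strictly equivalent to $\rho_B$. A cnl-ring ''is a universal deformation ring'' if it is the universal deformation ring for some topologically finitely generated profinite group $\Gamma$ and some continuous absolutely irreducible $\overline\rho:\Gamma\to GL_n(k)$. *)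

(* Defs.v *)
From HB Require Import structures.
From mathcomp Require Import all_boot all_order all_algebra.
From mathcomp Require Import finmap.
From mathcomp Require Import all_classical.
From mathcomp Require monalg.

Set Implicit Arguments.
Unset Strict Implicit.
Unset Printing Implicit Defensive.
Import GRing.Theory Num.Theory.
Local Open Scope ring_scope.

(* The n-th Witt polynomial: ghost p x n = \sum_(i <= n) p ^ i * x_i ^ (p ^ (n - i)). *)
Definition ghost (p : nat) (R : comNzRingType) (x : nat -> R) (n : nat) : R :=
  \sum_(i < n.+1) x i ^+ (p ^ (n - i)) *+ (p ^ i).

Lemma rmorph_ghost p (R S : comNzRingType) (f : {rmorphism R -> S})
    (x : nat -> R) n : f (ghost p x n) = ghost p (f \o x) n.
Proof.
by rewrite rmorph_sum; apply: eq_bigr => i _; rewrite rmorphMn rmorphXn.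
Qed.

Lemma ghostS p (R : comNzRingType) (x : nat -> R) n :
  ghost p x n =
  \sum_(i < n) x i ^+ (p ^ (n - i)) *+ (p ^ i) + x n *+ (p ^ n).
Proof. by rewrite /ghost big_ord_recr /= subnn expn0 expr1. Qed.

Section Congruence.
Variable R : comNzRingType.
Implicit Types (x y z : R) (m : nat).

Definition cong m x y := exists z, x = y + z *+ m.

Lemma cong_refl m x : cong m x x.
Proof. by exists 0; rewrite mul0rn addr0. Qed.

Lemma cong_trans m x y z : cong m x y -> cong m y z -> cong m x z.
Proof. by move=> [u ->] [v ->]; exists (v + u); rewrite mulrnDl addrA. Qed.

Lemma congD m x y x' y' :
  cong m x y -> cong m x' y' -> cong m (x + x') (y + y').
Proof. by move=> [u ->] [v ->]; exists (u + v); rewrite mulrnDl addrACA. Qed.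

Lemma congN m x y : cong m x y -> cong m (- x) (- y).
Proof. by move=> [u ->]; exists (- u); rewrite opprD mulNrn. Qed.

Lemma congM m x y x' y' :
  cong m x y -> cong m x' y' -> cong m (x * x') (y * y').
Proof.
move=> [u ->] [v ->]; exists (y * v + u * (y' + v *+ m)).
by rewrite mulrDl mulrDr mulrnDl !mulrnAl mulrnAr addrA.
Qed.

Lemma cong_sum (I : Type) (r : seq I) (P : pred I) m (F G : I -> R) :
  (forall i, P i -> cong m (F i) (G i)) ->
  cong m (\sum_(i <- r | P i) F i) (\sum_(i <- r | P i) G i).
Proof. by move=> h; elim/big_ind2: _ => // *; [exact: cong_refl|exact: congD]. Qed.

Lemma cong_mulrn m k x y : cong m x y -> cong (m * k) (x *+ k) (y *+ k).
Proof. by move=> [u ->]; exists u; rewrite mulrnDl mulrnA. Qed.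

Lemma cong_dvd m m' x y : (m' %| m)%N -> cong m x y -> cong m' x y.
Proof. by move=> /dvdnP[q ->] [u ->]; exists (u *+ q); rewrite mulrnA. Qed.

Variables (p : nat) (p_pr : prime p).

Lemma congXp_aux k x z : (0 < k)%N ->
  cong (p ^ k.+1) ((x + z *+ p ^ k) ^+ p) (x ^+ p).
Proof.
move=> k0; rewrite exprDn big_ord_recl /= subn0 expr0 mulr1 bin0.
rewrite -[X in cong _ _ X]addr0; apply: congD; first exact: cong_refl.
have s0 : \sum_(i < p) 0 = 0 :> R by rewrite big1.
rewrite -[X in cong _ _ X]s0; apply: cong_sum => i _; rewrite /bump /= add1n.
rewrite exprMn_n mulrnAr -mulrnA.
set u := _ * _; suff /dvdnP[q ->] : (p ^ k.+1 %| (p ^ k) ^ i.+1 * 'C(p, i.+1))%N.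
  by exists (u *+ q); rewrite add0r mulrnA.
have := ltn_ord i; rewrite leq_eqVlt => /orP[/eqP ip|ip].
  rewrite dvdn_mulr // -expnM dvdn_exp2l // ip.
  by rewrite ltn_Pmulr ?prime_gt1.
rewrite expnSr dvdn_mul ?prime_dvd_bin //.
by rewrite expnS dvdn_mulr.
Qed.

Lemma congXp k x y : (0 < k)%N -> cong (p ^ k) x y ->
  cong (p ^ k.+1) (x ^+ p) (y ^+ p).
Proof. by move=> k0 [z ->]; exact: congXp_aux. Qed.

Lemma congXpn k x y : cong p x y -> cong (p ^ k.+1) (x ^+ (p ^ k)) (y ^+ (p ^ k)).
Proof.
move=> xy; elim: k => [|k ih]; first by rewrite expn0 expn1 !expr1.
by rewrite (expnSr p k) !exprM; exact: congXp.
Qed.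

Lemma cong_freshman x y : cong p ((x + y) ^+ p) (x ^+ p + y ^+ p).
Proof.
have [p' def_p] : exists p', p = p'.+1 by exists p.-1; rewrite prednK ?prime_gt0.
rewrite exprDn def_p big_ord_recl big_ord_recr /= -def_p.
rewrite subn0 expr0 mulr1 bin0 mulr1n /bump /= add1n -def_p subnn binn.
rewrite expr0 mul1r mulr1n.
exists (\sum_(i < p') (x ^+ (p - i.+1) * y ^+ i.+1) *+ ('C(p, i.+1) %/ p)).
rewrite -addrA [y ^+ p + _]addrC -sumrMnl; congr (_ + (_ + _)).
apply: eq_bigr => i _; rewrite /bump /= add1n -mulrnA divnK //.
by rewrite prime_dvd_bin //= def_p ltnS.
Qed.

End Congruence.

Section Dwork.
Variables (p : nat) (p_pr : prime p) (T : comNzRingType).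
Hypothesis p_reg : forall x : T, x *+ p = 0 -> x = 0.

Let p_regX n (x : T) : x *+ p ^ n = 0 -> x = 0.
Proof.
by elim: n x => [|n ih] x; rewrite ?expn0 // expnS mulrnA => /ih/p_reg.
Qed.

Lemma ghost_inj (x y : nat -> T) : ghost p x =1 ghost p y -> x =1 y.
Proof.
move=> gxy n; elim/ltn_ind: n => n ih.
have := gxy n; rewrite !ghostS.
rewrite (eq_bigr (fun i : 'I_n => y i ^+ (p ^ (n - i)) *+ p ^ i)).
  move=> /addrI /eqP; rewrite -subr_eq0 -mulrnBl => /eqP/p_regX/eqP.
  by rewrite subr_eq0 => /eqP.
by move=> i _; rewrite ih.
Qed.

Variable phi : {rmorphism T -> T}.
Hypothesis phiP : forall x, cong p (phi x) (x ^+ p).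

Lemma ghost_frob (x : nat -> T) n :
  cong (p ^ n.+1) (\sum_(i < n.+1) x i ^+ (p ^ (n.+1 - i)) *+ (p ^ i))
    (phi (ghost p x n)).
Proof.
rewrite rmorph_ghost; apply: cong_sum => i _.
have le_in : (i <= n)%N by rewrite -ltnS.
have -> : (p ^ n.+1 = p ^ (n - i).+1 * p ^ i)%N by rewrite -expnD -subSn // subnK // ltnW.
apply: cong_mulrn; rewrite subSn // [in X in cong _ X _]expnS exprM; apply: congXpn => //=.
by have [z ->] := phiP (x i); exists (- z); rewrite mulNrn addrK.
Qed.

Lemma ghost_frobS (x : nat -> T) n :
  cong (p ^ n.+1) (ghost p x n.+1) (phi (ghost p x n)).
Proof.
rewrite ghostS -[X in cong _ _ X]addr0; apply: congD; first exact: ghost_frob.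
by exists (x n.+1); rewrite add0r.
Qed.

(* Dwork's lemma *)
Lemma ghost_surj (g : nat -> T) :
  (forall n, cong (p ^ n.+1) (g n.+1) (phi (g n))) ->
  exists x, forall n, ghost p x n = g n.
Proof.
move=> gP.
pose next n (x : nat -> T) : T :=
  xget 0 [set c | \sum_(i < n) x i ^+ (p ^ (n - i)) *+ (p ^ i) + c *+ (p ^ n)
                   = g n]%classic.
pose s := fix s n : seq T :=
  if n is m.+1 then rcons (s m) (next m (nth 0 (s m))) else [::].
have sz n : size (s n) = n by elim: n => //= n ih; rewrite size_rcons ih.
have sE m n i : (i < m)%N -> (m <= n)%N -> nth 0 (s n) i = nth 0 (s m) i.
  move=> im; elim: n => [|n ih]; first by rewrite leqn0 => /eqP m0; rewrite m0 in im.
  rewrite leq_eqVlt => /predU1P[->//|]; rewrite ltnS => mn /=.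
  by rewrite nth_rcons sz (leq_trans im mn) ih.
pose x i := nth 0 (s i.+1) i.
have nextE n : \sum_(i < n) x i ^+ (p ^ (n - i)) *+ (p ^ i)
  = \sum_(i < n) nth 0 (s n) i ^+ (p ^ (n - i)) *+ (p ^ i).
  by apply: eq_bigr => i _; rewrite /x -(sE i.+1 n).
have xn n : x n = next n (nth 0 (s n)).
  by rewrite /x /= nth_rcons sz ltnn eqxx.
exists x; elim => [|n ih]; rewrite ghostS nextE xn.
  apply: (@xgetPex _ 0 [set c | _ + c *+ _ = g _]%classic).
  by exists (g 0%N); rewrite /= big_ord0 add0r.
apply: (@xgetPex _ 0 [set c | _ + c *+ _ = g _]%classic).
rewrite /= -nextE.
have [u ->] := ghost_frob x n; rewrite ih.
have [v ->] := gP n.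
by exists (v - u); rewrite mulrnBl -!addrA [u *+ _ + _]addrC subrK.
Qed.

End Dwork.

(* zpoly = Z[X j i | j, i : nat], as the algebra of the free commutative monoid on
   nat * nat. *)
Module ZPoly.
Import monalg.

Definition monom := cmonom (nat * nat)%type.
Definition zpoly : comNzRingType := malg monom int.

HB.lock Definition X (j i : nat) : zpoly := mkmalgU (ucm (j, i)) 1.

Section ZPoly.

Section Eval.
Variables (R : comNzRingType) (v : nat -> nat -> R).

Definition meval (m : monom) : R :=
  \prod_(k <- finsupp m) v k.1 k.2 ^+ m k.

Lemma mevalEw (d : {fset nat * nat}) (m : monom) : (finsupp m `<=` d)%fset ->
  meval m = \prod_(k <- d) v k.1 k.2 ^+ m k.
Proof.
move=> le; rewrite /meval [LHS](big_fset_incl _ le) //= => x _.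
by move=> /fsfun_dflt ->; rewrite expr0.
Qed.

Lemma meval_mmorphism : mmorphism meval.
Proof.
split=> [m1 m2|]; last by rewrite /meval mdom1 big_seq_fset0.
rewrite (@mevalEw (finsupp m1 `|` finsupp m2)%fset (mul m1 m2)) ?mdomD ?fsubset_refl //.
rewrite (@mevalEw (finsupp m1 `|` finsupp m2)%fset m1) ?fsubsetUl //.
rewrite (@mevalEw (finsupp m1 `|` finsupp m2)%fset m2) ?fsubsetUr //.
by rewrite -big_split; apply: eq_bigr => k _; rewrite cmM exprD.
Qed.

HB.instance Definition _ := isMultiplicative.Build monom R meval meval_mmorphism.

Definition eval : zpoly -> R := mmap (intr : int -> R) meval.
HB.instance Definition _ := GRing.RMorphism.on eval.

Lemma evalX j i : eval (X j i) = v j i.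
Proof.
by rewrite /eval X.unlock mmapU mul1r /meval mdomU big_seq_fset1 cmUU expr1.
Qed.

End Eval.

Lemma eval_comp (R S : comNzRingType) (f : {rmorphism R -> S})
    (v : nat -> nat -> R) q :
  f (eval v q) = eval (fun j i => f (v j i)) q.
Proof.
rewrite /eval /mmap rmorph_sum; apply: eq_bigr => m _.
rewrite rmorphM rmorph_int rmorph_prod; congr (_ * _).
by apply: eq_bigr => k _; rewrite rmorphXn.
Qed.

Lemma mulrn_eq0 (n : nat) (q : zpoly) : (0 < n)%N -> q *+ n = 0 -> q = 0.
Proof.
move=> n0 qn; apply/malgP => m; have /malgP/(_ m) := qn.
rewrite mcoeffMn mcoeff0 => /eqP; rewrite mulrn_eq0 => /orP[|/eqP //].
by rewrite eqn0Ngt n0.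
Qed.

Variables (p : nat) (p_pr : prime p).

Let mfrob (m : monom) : zpoly := mkmalgU m 1 ^+ p.

Let mkmalgM (m1 m2 : monom) (a b : int) :
  mkmalgU (mul m1 m2) (a * b) = mkmalgU m1 a * mkmalgU m2 b :> zpoly.
Proof. by rewrite malgM_def fgmulUU. Qed.

Let mfrob_mmorphism : mmorphism mfrob.
Proof.
split=> [m1 m2|]; last by rewrite /mfrob expr1n.
by rewrite /mfrob -exprMn -mkmalgM mulr1.
Qed.

HB.instance Definition _ := isMultiplicative.Build monom zpoly mfrob mfrob_mmorphism.

Definition frob : {rmorphism zpoly -> zpoly} := mmap (intr : int -> zpoly) mfrob.

Let fermat (a : int) : exists b : int, a ^+ p = a + b *+ p.
Proof.
have nat_fermat (n : nat) : exists b : int, n%:Z ^+ p = n%:Z + b *+ p.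
  elim: n => [|n [b e]]; first by exists 0; rewrite expr0n gtn_eqF ?prime_gt0 // mul0rn addr0.
  have [z] := @cong_freshman int p p_pr n%:Z 1.
  rewrite expr1n e -PoszD addn1 => ->; exists (b + z).
  by rewrite mulrnDl -[n.+1]addn1 PoszD [RHS]addrACA addrA.
case: a => n; first exact: nat_fermat.
have [b e] := nat_fermat n.+1.
rewrite NegzE exprNn e.
have [->|p_odd] := even_prime p_pr.
  exists (n.+1%:Z + b); rewrite expr2 mulrNN mulr1 mul1r !mulrnDl.
  by rewrite [n.+1%:Z *+ 2]mulr2n -[n.+1%:Z + n.+1%:Z + _]addrA addKr.
by exists (- b); rewrite -signr_odd p_odd expr1 mulN1r opprD mulNrn.
Qed.

Lemma frobP q : cong p (frob q) (q ^+ p).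
Proof.
rewrite [q]monalgE; elim: (msupp q : seq _) => [|m r ih].
  by rewrite big_nil rmorph0 expr0n gtn_eqF ?prime_gt0 //; exact: cong_refl.
rewrite big_cons rmorphD.
suff: cong p (frob (mkmalgU m (mcoeff m q))) (mkmalgU m (mcoeff m q) ^+ p).
  move=> h; apply: cong_trans (congD h ih) _.
  have [z ->] := cong_freshman p_pr (mkmalgU m (mcoeff m q)) (\sum_(j <- r) mkmalgU j (mcoeff j q)).
  by exists (- z); rewrite mulNrn addrK.
move: (mcoeff m q) => a; rewrite /= mmapU /mfrob.
have -> : mkmalgU m a = a%:~R * mkmalgU m 1 :> zpoly.
  rewrite -[X in mkmalgU _ X = _](intz a) [LHS](raddfMz (@mkmalgU _ _ m)).
  by rewrite mulrzl.
rewrite exprMn; apply: congM; last exact: cong_refl.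
have [b e] := fermat a; rewrite -rmorphXn /= e rmorphD rmorphMn /=.
by exists (- b%:~R); rewrite mulNrn addrK.
Qed.

End ZPoly.
End ZPoly.

Section WittPolynomials.
Import ZPoly.
Variables (p : nat) (p_pr : prime p).

Let solve := ghost_surj p_pr (frobP p_pr).

Let XP j n := ghost_frobS p_pr (frobP p_pr) (X j) n.

(* The integral polynomials giving the coordinates of the sum, product and
   opposite of Witt vectors with coordinates (X 0 i)_i and (X 1 i)_i; they are
   uniquely determined by these equations, see ghost_inj. *)
Lemma add_polyP : exists S : nat -> zpoly,
  forall n, ghost p S n = ghost p (X 0) n + ghost p (X 1) n.
Proof. by apply: solve => n; rewrite rmorphD; apply: congD; exact: XP. Qed.

Lemma mul_polyP : exists P : nat -> zpoly,
  forall n, ghost p P n = ghost p (X 0) n * ghost p (X 1) n.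
Proof. by apply: solve => n; rewrite rmorphM; apply: congM; exact: XP. Qed.

Lemma opp_polyP : exists N : nat -> zpoly,
  forall n, ghost p N n = - ghost p (X 0) n.
Proof. by apply: solve => n; rewrite rmorphN; apply: congN; exact: XP. Qed.

Definition add_poly : nat -> zpoly := projT1 (cid add_polyP).
Definition mul_poly : nat -> zpoly := projT1 (cid mul_polyP).
Definition opp_poly : nat -> zpoly := projT1 (cid opp_polyP).

Lemma add_polyE n : ghost p add_poly n = ghost p (X 0) n + ghost p (X 1) n.
Proof. exact: (projT2 (cid add_polyP)). Qed.

Lemma mul_polyE n : ghost p mul_poly n = ghost p (X 0) n * ghost p (X 1) n.
Proof. exact: (projT2 (cid mul_polyP)). Qed.

Lemma opp_polyE n : ghost p opp_poly n = - ghost p (X 0) n.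
Proof. exact: (projT2 (cid opp_polyP)). Qed.

End WittPolynomials.

Definition witt_env (R : comNzRingType) (x y : nat -> R) (j : nat) : nat -> R :=
  if j is 0 then x else y.

HB.lock Definition witt_add (p : nat) (p_pr : prime p) (R : comNzRingType)
  (x y : nat -> R) : nat -> R :=
  fun n => ZPoly.eval (witt_env x y) (add_poly p_pr n).

HB.lock Definition witt_mul (p : nat) (p_pr : prime p) (R : comNzRingType)
  (x y : nat -> R) : nat -> R :=
  fun n => ZPoly.eval (witt_env x y) (mul_poly p_pr n).

HB.lock Definition witt_opp (p : nat) (p_pr : prime p) (R : comNzRingType)
  (x : nat -> R) : nat -> R :=
  fun n => ZPoly.eval (fun=> x) (opp_poly p_pr n).

Definition witt_zero (R : comNzRingType) (n : nat) : R := 0.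

Definition witt_one (R : comNzRingType) (n : nat) : R := (n == 0%N)%:R.

Section WittGhost.
Import ZPoly.
Variables (p : nat) (p_pr : prime p) (R : comNzRingType).
Implicit Types x y z : nat -> R.

Let eval_ghostX (v : nat -> nat -> R) j n :
  eval v (ghost p (X j) n) = ghost p (v j) n.
Proof.
by rewrite rmorph_ghost; congr ghost; apply/funext => i; exact: evalX.
Qed.

Lemma ghost_add x y n :
  ghost p (witt_add p_pr x y) n = ghost p x n + ghost p y n.
Proof.
rewrite witt_add.unlock.
apply: etrans (esym (rmorph_ghost p (eval (witt_env x y)) (add_poly p_pr) n)) _.
rewrite add_polyE; apply: etrans (rmorphD _ _ _) _.
by apply: (congr2 +%R); exact: eval_ghostX.
Qed.

Lemma ghost_mul x y n :
  ghost p (witt_mul p_pr x y) n = ghost p x n * ghost p y n.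
Proof.
rewrite witt_mul.unlock.
apply: etrans (esym (rmorph_ghost p (eval (witt_env x y)) (mul_poly p_pr) n)) _.
rewrite mul_polyE; apply: etrans (rmorphM _ _ _) _.
by apply: (congr2 *%R); exact: eval_ghostX.
Qed.

Lemma ghost_opp x n : ghost p (witt_opp p_pr x) n = - ghost p x n.
Proof.
rewrite witt_opp.unlock.
apply: etrans (esym (rmorph_ghost p (eval (fun=> x)) (opp_poly p_pr) n)) _.
rewrite opp_polyE; apply: etrans (rmorphN _ _) _.
by apply: (congr1 -%R); exact: eval_ghostX.
Qed.

Lemma ghost_zero n : ghost p (@witt_zero R) n = 0.
Proof.
apply: big1 => i _; rewrite /witt_zero expr0n.
by rewrite expn_eq0 eqn0Ngt prime_gt0 //= mul0rn.
Qed.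

Lemma ghost_one n : ghost p (@witt_one R) n = 1.
Proof.
rewrite /ghost big_ord_recl /= /witt_one /= expr1n big1 ?addr0 // => i _.
by rewrite expr0n expn_eq0 eqn0Ngt prime_gt0 //= mul0rn.
Qed.

End WittGhost.

Section WittFunctoriality.
Import ZPoly.
Variables (p : nat) (p_pr : prime p) (R S : comNzRingType).
Variable f : {rmorphism R -> S}.

Lemma map_witt_add (x y : nat -> R) :
  f \o witt_add p_pr x y = witt_add p_pr (f \o x) (f \o y).
Proof.
apply/funext => n; rewrite witt_add.unlock /= eval_comp.
by congr eval; apply/funext => -[].
Qed.

Lemma map_witt_mul (x y : nat -> R) :
  f \o witt_mul p_pr x y = witt_mul p_pr (f \o x) (f \o y).
Proof.
apply/funext => n; rewrite witt_mul.unlock /= eval_comp.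
by congr eval; apply/funext => -[].
Qed.

Lemma map_witt_opp (x : nat -> R) :
  f \o witt_opp p_pr x = witt_opp p_pr (f \o x).
Proof. by apply/funext => n; rewrite witt_opp.unlock /= eval_comp. Qed.

Lemma map_witt_zero : f \o @witt_zero R = @witt_zero S.
Proof. by apply/funext => n; rewrite /= /witt_zero rmorph0. Qed.

Lemma map_witt_one : f \o @witt_one R = @witt_one S.
Proof. by apply/funext => n; rewrite /= /witt_one rmorph_nat. Qed.

End WittFunctoriality.

Section WittAxioms.
Import ZPoly.
Variables (p : nat) (p_pr : prime p) (R : comNzRingType).
Implicit Types x y z : nat -> R.
Local Notation add := (@witt_add p p_pr R).
Local Notation mul := (@witt_mul p p_pr R).
Local Notation opp := (@witt_opp p p_pr R).

Let ghost_eq (a b : nat -> zpoly) : ghost p a =1 ghost p b -> a = b.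
Proof.
move=> ab; apply/funext/(@ghost_inj p zpoly) => // q.
exact/mulrn_eq0/prime_gt0.
Qed.

Let lift x y z :
  {f : {rmorphism zpoly -> R} & [/\ x = f \o X 0, y = f \o X 1 & z = f \o X 2]}.
Proof.
exists (eval (fun j => nth x [:: x; y; z] j)).
by split; apply/funext => i; apply/esym; exact: evalX.
Qed.

Let mapE := (map_witt_add, map_witt_mul, map_witt_opp, map_witt_zero,
  map_witt_one).
Let ghostE := (@ghost_add p p_pr, @ghost_mul p p_pr, @ghost_opp p p_pr,
  @ghost_zero p p_pr, @ghost_one p p_pr).

Lemma witt_addA : associative add.
Proof.
move=> x y z; have [f [-> -> ->]] := lift x y z; rewrite -!mapE.
by apply: (congr1 (comp f)); apply: ghost_eq => n; rewrite !ghostE; exact: addrA.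
Qed.

Lemma witt_addC : commutative add.
Proof.
move=> x y; have [f [-> -> _]] := lift x y x; rewrite -!mapE.
by apply: (congr1 (comp f)); apply: ghost_eq => n; rewrite !ghostE; exact: addrC.
Qed.

Lemma witt_add0 : left_id (@witt_zero R) add.
Proof.
move=> x; have [f [-> _ _]] := lift x x x; rewrite -(map_witt_zero f) -!mapE.
by apply: (congr1 (comp f)); apply: ghost_eq => n; rewrite !ghostE; exact: add0r.
Qed.

Lemma witt_addN : left_inverse (@witt_zero R) opp add.
Proof.
move=> x; have [f [-> _ _]] := lift x x x; rewrite -(map_witt_zero f) -!mapE.
by apply: (congr1 (comp f)); apply: ghost_eq => n; rewrite !ghostE; exact: addNr.
Qed.

Lemma witt_mulA : associative mul.
Proof.
move=> x y z; have [f [-> -> ->]] := lift x y z; rewrite -!mapE.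
by apply: (congr1 (comp f)); apply: ghost_eq => n; rewrite !ghostE; exact: mulrA.
Qed.

Lemma witt_mulC : commutative mul.
Proof.
move=> x y; have [f [-> -> _]] := lift x y x; rewrite -!mapE.
by apply: (congr1 (comp f)); apply: ghost_eq => n; rewrite !ghostE; exact: mulrC.
Qed.

Lemma witt_mul1 : left_id (@witt_one R) mul.
Proof.
move=> x; have [f [-> _ _]] := lift x x x; rewrite -(map_witt_one f) -!mapE.
by apply: (congr1 (comp f)); apply: ghost_eq => n; rewrite !ghostE; exact: mul1r.
Qed.

Lemma witt_mulDl : left_distributive mul add.
Proof.
move=> x y z; have [f [-> -> ->]] := lift x y z; rewrite -!mapE.
by apply: (congr1 (comp f)); apply: ghost_eq => n; rewrite !ghostE; exact: mulrDl.
Qed.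

Lemma witt_one_neq0 : @witt_one R <> @witt_zero R.
Proof. by move=> /(congr1 (@^~ 0%N))/eqP; rewrite /witt_one oner_eq0. Qed.

End WittAxioms.

(* The ring W(R) of p-typical Witt vectors of R; W(R) -> R is witt_coord _ 0. *)
Record witt (p : nat) (p_pr : prime p) (R : comNzRingType) :=
  Witt { witt_coord : nat -> R }.

Section WittRing.
Variables (p : nat) (p_pr : prime p) (R : comNzRingType).
Local Notation W := (witt p_pr R).
Local Notation coord := (@witt_coord p p_pr R).

HB.instance Definition _ := gen_eqMixin W.
HB.instance Definition _ := gen_choiceMixin W.

Definition wadd (x y : W) := Witt p_pr (witt_add p_pr (coord x) (coord y)).
Definition wmul (x y : W) := Witt p_pr (witt_mul p_pr (coord x) (coord y)).
Definition wopp (x : W) := Witt p_pr (witt_opp p_pr (coord x)).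
Definition wzero := Witt p_pr (@witt_zero R).
Definition wone := Witt p_pr (@witt_one R).

Fact waddA : associative wadd.
Proof. by move=> *; congr Witt; exact: witt_addA. Qed.
Fact waddC : commutative wadd.
Proof. by move=> *; congr Witt; exact: witt_addC. Qed.
Fact wadd0 : left_id wzero wadd.
Proof. by case=> x; congr Witt; exact: witt_add0. Qed.
Fact waddN : left_inverse wzero wopp wadd.
Proof. by case=> x; congr Witt; exact: witt_addN. Qed.
Fact wmulA : associative wmul.
Proof. by move=> *; congr Witt; exact: witt_mulA. Qed.
Fact wmulC : commutative wmul.
Proof. by move=> *; congr Witt; exact: witt_mulC. Qed.
Fact wmul1 : left_id wone wmul.
Proof. by case=> x; congr Witt; exact: witt_mul1. Qed.
Fact wmulDl : left_distributive wmul wadd.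
Proof. by move=> *; congr Witt; exact: witt_mulDl. Qed.
Fact wone_neq0 : wone != wzero.
Proof. by apply/eqP => -[]; exact: witt_one_neq0. Qed.

HB.instance Definition _ := GRing.isZmodule.Build W waddA waddC wadd0 waddN.
HB.instance Definition _ := GRing.Zmodule_isComNzRing.Build W
  wmulA wmulC wmul1 wmulDl wone_neq0.
End WittRing.

(* Imported only here: its notations clash with those of monalg. *)
From mathcomp Require Import all_analysis.
Local Open Scope classical_set_scope.

Section Ideals.
Variable R : comNzRingType.

Definition is_ideal (I : set R) : Prop :=
  [/\ I 0, forall x y, I x -> I y -> I (x + y) & forall a x, I x -> I (a * x)].

Definition ideal_gen (S : set R) : set R := smallest is_ideal S.

(* I ^ n is generated by the n-fold products of elements of I; I ^ 0 = R. *)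
Definition ideal_pow (I : set R) (n : nat) : set R :=
  ideal_gen [set \prod_(i < n) f i | f in [set f : 'I_n -> R | forall i, I (f i)]].

Definition noetherian : Prop :=
  forall I, is_ideal I -> exists s : seq R, I = ideal_gen [set` s].

(* R -> lim_n R / I ^ n is injective and surjective. *)
Definition adically_complete (I : set R) : Prop :=
  \bigcap_n ideal_pow I n = [set 0] /\
  forall u : nat -> R, (forall n, ideal_pow I n (u n.+1 - u n)) ->
    exists x, forall n, ideal_pow I n (x - u n).

Lemma is_ideal_gen (S : set R) : is_ideal (ideal_gen S).
Proof.
split=> [J [[]] //|x y Sx Sy J SJ|a x Sx J SJ].
  by case: (SJ) => -[_ + _] _; apply; [exact: Sx|exact: Sy].
by case: (SJ) => -[_ _ +] _; apply; exact: Sx.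
Qed.

Lemma is_ideal_pow (I : set R) n : is_ideal (ideal_pow I n).
Proof. exact: is_ideal_gen. Qed.

Lemma ideal_pow_sub (I : set R) m n :
  (m <= n)%N -> ideal_pow I n `<=` ideal_pow I m.
Proof.
move=> /subnKC <-; move: (n - m)%N => d {n}.
apply: smallest_sub => [|_ [f fI <-]]; first exact: is_ideal_pow.
have [_ _ Imul] := is_ideal_pow I m; rewrite big_split_ord /= mulrC.
apply: Imul => J [_]; apply.
by exists (fun i => f (lshift d i)) => // i; exact: fI.
Qed.

End Ideals.

(* The ring R with the I-adic topology. *)
Definition adic_topology (R : comNzRingType) (I : set R) : Type := R.

Section AdicTopology.
Variables (R : comNzRingType) (I : set R).
Local Notation T := (adic_topology I).

HB.instance Definition _ := Choice.copy T R.

Definition adic_nbhs (x : T) : set_system T :=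
  filter_from [set: nat]
    (fun n => [set y : T | ideal_pow I n ((y : R) - (x : R))]).

HB.instance Definition _ := hasNbhs.Build T adic_nbhs.

Let adic_nbhs_filter (x : T) : ProperFilter (nbhs x).
Proof.
apply: filter_from_proper => [|n _].
  apply: filter_from_filter; first by exists 0%N.
  move=> i j _ _; exists (maxn i j) => // y /= h; split.
    exact: ideal_pow_sub (leq_maxl i j) _ h.
  exact: ideal_pow_sub (leq_maxr i j) _ h.
exists x => /=; rewrite subrr.
by have [] := is_ideal_pow I n.
Qed.

Let adic_nbhs_singleton (x : T) (A : set T) : nbhs x A -> A x.
Proof.
move=> [n _]; apply; rewrite /= subrr.
by have [] := is_ideal_pow I n.
Qed.

Let adic_nbhs_nbhs (x : T) (A : set T) : nbhs x A -> nbhs x (nbhs^~ A).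
Proof.
move=> [n _ nA]; exists n => // y /= xy; exists n => // z /= yz.
apply: nA => /=; rewrite -(subrK (y : R) (z : R)) -addrA.
have [_ + _] := is_ideal_pow I n.
by apply.
Qed.

HB.instance Definition _ := Nbhs_isNbhsTopological.Build T
  adic_nbhs_filter adic_nbhs_singleton adic_nbhs_nbhs.

End AdicTopology.

(* Complete noetherian local W(k)-algebras with residue field k. The map cnl_res
   realizes A / m_A = k: its kernel is the set of non-units, and compatibility
   with the reduction W(k) -> k makes it surjective and uniquely determined by
   the W(k)-algebra A. *)
Record cnlRing (p : nat) (p_pr : prime p) (k : finFieldType) := CnlRing {
  cnl_alg :> comUnitAlgType (witt p_pr k);
  cnl_res : {rmorphism cnl_alg -> k};
  cnl_res_scalar : forall w : witt p_pr k, cnl_res w%:A = witt_coord w 0;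
  cnl_local : forall a : cnl_alg, (cnl_res a == 0) = (a \isn't a GRing.unit);
  cnl_noetherian : noetherian cnl_alg;
  cnl_complete :
    adically_complete [set a : cnl_alg | a \isn't a GRing.unit]
}.


Definition max_ideal (p : nat) (p_pr : prime p) (k : finFieldType)
  (A : cnlRing p_pr k) : set A := [set a | a \isn't a GRing.unit].
Arguments max_ideal {p p_pr k} A _.

Definition madic (p : nat) (p_pr : prime p) (k : finFieldType)
  (A : cnlRing p_pr k) : topologicalType := adic_topology (max_ideal A).

HB.structure Definition PreTopologicalGroup := {G of Group G & Topological G}.

Local Open Scope group_scope.

Definition profinite_group (G : PreTopologicalGroup.type) : Prop :=
  [/\ continuous (fun x : G * G => x.1 * x.2),
      continuous (fun x : G => x^-1),
      compact [set: G], hausdorff_space G & totally_disconnected [set: G]].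

Definition is_subgroup (G : groupType) (H : set G) : Prop :=
  [/\ H 1, forall x y, H x -> H y -> H (x * y) & forall x, H x -> H x^-1].

(* Some finite set generates a dense subgroup. *)
Definition topologically_finitely_generated
    (G : PreTopologicalGroup.type) : Prop :=
  exists s : seq G, dense (smallest (@is_subgroup G) [set` s]).

Local Close Scope group_scope.

Section Representations.
Variables (G : groupType) (n : nat).

(* Homomorphisms G -> GL_n(R). *)
Definition is_representation (R : comUnitRingType) (rho : G -> 'M[R]_n) : Prop :=
  [/\ forall g, rho g \in unitmx, rho 1%g = 1%:M &
      forall g h, rho (g * h)%g = rho g *m rho h].

Definition irreducible_representation (F : fieldType) (rho : G -> 'M[F]_n) :=
  (0 < n)%N /\
  forall V : {vspace 'cV[F]_n},
    (forall g v, v \in V -> rho g *m v \in V) -> V = 0%VS \/ V = fullv.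

Definition absolutely_irreducible (F : fieldType) (rho : G -> 'M[F]_n) :=
  forall (L : fieldType) (iota : {rmorphism F -> L}),
    irreducible_representation (fun g => map_mx iota (rho g)).

End Representations.

Section Deformations.
Variables (p : nat) (p_pr : prime p) (k : finFieldType).
Variables (G : PreTopologicalGroup.type) (n : nat).
Implicit Types (R B : cnlRing p_pr k) (rhobar : G -> 'M[k]_n).

(* As GL_n(B) carries the topology induced by M_n(B), continuity is stated for
   the map to M_n(B). *)
Definition is_lift rhobar B (rho : G -> 'M[B]_n) : Prop :=
  [/\ is_representation rho, continuous (rho : G -> 'M[madic B]_n) &
      forall g, map_mx (@cnl_res _ _ _ B) (rho g) = rhobar g].

Definition strictly_equivalent B (rho1 rho2 : G -> 'M[B]_n) : Prop :=
  exists X : 'M[B]_n,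
    [/\ X \in unitmx, map_mx (@cnl_res _ _ _ B) X = 1%:M &
        forall g, rho2 g = invmx X *m rho1 g *m X].

Definition is_local_morphism R B (f : R -> B) : Prop :=
  f @` max_ideal R `<=` max_ideal B.

Record is_universal_deformation rhobar R (rhoR : G -> 'M[R]_n) : Prop := {
  udr_profinite : profinite_group G;
  udr_tfg : topologically_finitely_generated G;
  udr_rep : is_representation rhobar;
  udr_cont : continuous (rhobar : G -> 'M[discrete_topology k]_n);
  udr_absirr : absolutely_irreducible rhobar;
  udr_lift : is_lift rhobar rhoR;
  udr_universal : forall B (rhoB : G -> 'M[B]_n), is_lift rhobar rhoB ->
    exists pi : {lrmorphism R -> B},
      [/\ is_local_morphism pi,
          strictly_equivalent (fun g => map_mx pi (rhoR g)) rhoB &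
          forall pi' : {lrmorphism R -> B}, is_local_morphism pi' ->
            strictly_equivalent (fun g => map_mx pi' (rhoR g)) rhoB ->
            pi' =1 pi]
}.

End Deformations.

Definition is_universal_deformation_ring (p : nat) (p_pr : prime p)
    (k : finFieldType) (R : cnlRing p_pr k) : Prop :=
  exists (G : PreTopologicalGroup.type) (n : nat) (rhobar : G -> 'M[k]_n)
    (rhoR : G -> 'M[R]_n), is_universal_deformation rhobar rhoR.

Record SL (n : nat) (R : comUnitRingType) :=
  MkSL { SLval :> 'M[R]_n; _ : \det SLval == 1 }.

Section SpecialLinear.
Variables (n : nat) (R : comUnitRingType).
Local Notation S := (SL n R).
Implicit Types x y z : S.

HB.instance Definition _ := [isSub for @SLval n R].
HB.instance Definition _ := [Choice of S by <:].

Lemma det_SL x : \det x = 1.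
Proof. by case: x => x /= /eqP. Qed.

Lemma SL_unitmx x : (x : 'M[R]_n) \in unitmx.
Proof. by rewrite unitmxE det_SL unitr1. Qed.

Fact SL_one_subproof : \det (1%:M : 'M[R]_n) == 1.
Proof. by rewrite det1. Qed.
Fact SL_mul_subproof x y : \det (x *m y) == 1.
Proof. by rewrite det_mulmx !det_SL mulr1. Qed.
Fact SL_inv_subproof x : \det (invmx x) == 1.
Proof. by rewrite det_inv det_SL invr1. Qed.

Definition SL_one := MkSL SL_one_subproof.
Definition SL_mul x y := MkSL (SL_mul_subproof x y).
Definition SL_inv x := MkSL (SL_inv_subproof x).

Fact SL_mulA : associative SL_mul.
Proof. by move=> x y z; apply/val_inj; exact: mulmxA. Qed.
Fact SL_mul1g : left_id SL_one SL_mul.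
Proof. by move=> x; apply/val_inj; exact: mul1mx. Qed.
Fact SL_mulg1 : right_id SL_one SL_mul.
Proof. by move=> x; apply/val_inj; exact: mulmx1. Qed.
Fact SL_mulVg : left_inverse SL_one SL_inv SL_mul.
Proof. by move=> x; apply/val_inj; exact: mulVmx (SL_unitmx x). Qed.
Fact SL_mulgV : right_inverse SL_one SL_inv SL_mul.
Proof. by move=> x; apply/val_inj; exact: mulmxV (SL_unitmx x). Qed.

HB.instance Definition _ := isGroup.Build S
  SL_mulA SL_mul1g SL_mulg1 SL_mulVg SL_mulgV.

End SpecialLinear.

(* SL_n(A) with the topology induced by the m_A-adic topology of M_n(A). *)
Definition topSL (n : nat) (p : nat) (p_pr : prime p) (k : finFieldType)
  (A : cnlRing p_pr k) : Type := SL n A.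

Section TopSL.
Variables (n p : nat) (p_pr : prime p) (k : finFieldType) (A : cnlRing p_pr k).

HB.instance Definition _ := Group.copy (topSL n A) (SL n A).
HB.instance Definition _ := Topological.copy (topSL n A)
  (initial_topology (@SLval n A : SL n A -> 'M[madic A]_n)).

Definition std_rep (g : topSL n A) : 'M[A]_n := SLval g.

Definition residual_rep (g : topSL n A) : 'M[k]_n :=
  map_mx (@cnl_res _ _ _ A) (std_rep g).

End TopSL.
Arguments std_rep n {p p_pr k} A g.
Arguments residual_rep n {p p_pr k} A g.

(* Main.v *)
Require Import Defs.
From HB Require Import structures.
From mathcomp Require Import all_boot all_order all_algebra all_fingroup cyclic ring.
From mathcomp Require Import all_classical all_analysis.
Import GRing.Theory.
Local Open Scope ring_scope.
Set Implicit Arguments.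
Unset Strict Implicit.
Unset Printing Implicit Defensive.

(* Let rho be a lift to GL_n(B), and m the maximal ideal of B; everything is read off the
   matrices rho(E_ij(a)), which generate the image. First rho is conjugated, strictly, so that
   some of its values become standard.
   - If k <> F_2, this is done on the finite torus of diagonal Teichmueller matrices, whose
     order is prime to p, by averaging.
   - If k = F_2 and n >= 5, each pair {i, j} gives an element of order 3 of SL_2(Z), hence a
     rank 2 summand V_ij of B^n. The E_lm(a) with l, m outside {i, j} act on V_ij, trivially
     modulo m; they act trivially, being in the normal closure of elements of order 3, while the
     kernel of reduction has none. The intersection of V_ij and V_it is spanned by a lift f_i of
     the i-th basis vector, fixed by all the E_lm(a) with l, m <> i, and (f_i) is the new basis.
   Now write rho(E_ij(a)) = E_ij(b) + P with P_ij = 0. If the entries of all these P are in m^N,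
   N >= 1, then modulo m^(N+1) the commutation relations between elementary matrices are linear
   in P, and force P = 0. By induction and completeness P = 0. After rescaling the basis, the
   commutator relations say that b is the image of a under a single ring morphism A -> B, and it
   is W(k)-linear because W(k) -> B is determined by its reduction. A matrix intertwining two
   such morphisms commutes with the E_ij(1), whence uniqueness. *)

(** * Elementary matrices *)

HB.lock Definition elem (R : comNzRingType) (n : nat) (i j : 'I_n) (a : R) : 'M[R]_n :=
  1%:M + a *: delta_mx i j.
Arguments elem {R n} i j a.

Section Elementary.
Variables (R : comNzRingType) (n : nat).
Implicit Types (i j l m r s : 'I_n) (a b : R).

Lemma elem_def i j a : elem i j a = 1%:M + a *: delta_mx i j.
Proof. by rewrite elem.unlock. Qed.

Lemma elemE i j a r s :
  elem i j a r s = (r == s)%:R + a * ((r == i) && (s == j))%:R.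
Proof. by rewrite !elem_def !mxE. Qed.

Lemma elem0 i j : elem i j (0 : R) = 1%:M.
Proof. by rewrite !elem_def scale0r addr0. Qed.

Lemma elem_mul i j l m a b : elem i j a *m elem l m b =
  elem i j a + b *: delta_mx l m + (a * b) *: (delta_mx i m *+ (j == l)).
Proof.
rewrite !elem_def mulmxDr mulmx1 mulmxDl mul1mx addrA; congr (_ + _).
by rewrite -scalemxAl -scalemxAr scalerA mul_delta_mx_cond.
Qed.

Lemma elemD i j a b : i != j -> elem i j (a + b) = elem i j a *m elem i j b.
Proof.
move=> ij; rewrite elem_mul eq_sym (negbTE ij) mulr0n scaler0 addr0.
by rewrite !elem_def scalerDl addrA.
Qed.

Lemma elemNK i j a : i != j -> elem i j (- a) *m elem i j a = 1%:M.
Proof. by move=> ij; rewrite -elemD // addNr elem0. Qed.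

Lemma elem_comm i j l m a b : j != l -> i != m ->
  elem i j a *m elem l m b = elem l m b *m elem i j a.
Proof.
move=> jl im; rewrite !elem_mul (negbTE jl) eq_sym (negbTE im) !scaler0 !addr0.
by rewrite !elem_def addrAC.
Qed.

(** The relation [E_ij(a), E_jl(b)] = E_il(ab), with inverses cleared so that it can be imposed on
    matrices not yet known to be invertible, as in [elementary_system]. *)
Lemma elem_commutator i j l a b : i != j -> j != l -> i != l ->
  elem i j a *m elem j l b = elem i l (a * b) *m (elem j l b *m elem i j a).
Proof.
move=> ij jl il.
rewrite !elem_mul eqxx (eq_sym l) (negbTE il) mulr0n scaler0 addr0 mulr1n.
rewrite [elem i l _ in RHS]elem_def mulmxDl mul1mx.
have -> : (a * b) *: delta_mx i l *m (elem j l b + a *: delta_mx i j) =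
    (a * b) *: delta_mx i l.
  rewrite !elem_def -scalemxAl !mulmxDr mulmx1 -!scalemxAr !mul_delta_mx_cond.
  by rewrite !(eq_sym l) (negbTE jl) (negbTE il) !mulr0n !scaler0 !addr0.
by congr (_ + _); rewrite !elem_def addrAC.
Qed.

Lemma det_elem i j a : i != j -> \det (elem i j a) = 1.
Proof.
have low (i' j' : 'I_n) : (j' < i')%N -> \det (elem i' j' a) = 1.
  move=> ji; rewrite det_trig; last first.
    apply/is_trig_mxP => r s rs; rewrite elemE.
    rewrite -val_eqE /= (ltn_eqF rs) add0r.
    have [ri|] := eqVneq r i'; last by rewrite mulr0.
    have [sj|] := eqVneq s j'; last by rewrite mulr0.
    by move: rs; rewrite ri sj => /ltn_trans/(_ ji); rewrite ltnn.
  apply: big1 => r _; rewrite elemE eqxx.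
  have [ri|] := eqVneq r i'; last by rewrite mulr0 addr0.
  have [rj|] := eqVneq r j'; last by rewrite mulr0 addr0.
  by rewrite -ri -rj ltnn in ji.
move=> ij; case: (ltngtP i j) => [lt|gt|/val_inj e]; last by rewrite e eqxx in ij.
  rewrite -det_tr -[RHS](low j i lt); congr (\det _).
  by rewrite !elem_def linearD linearZ /= trmx1 trmx_delta.
exact: low.
Qed.

Definition elem_word (w : seq ('I_n * 'I_n * R)) : 'M[R]_n :=
  foldr (fun t M => elem t.1.1 t.1.2 t.2 *m M) 1%:M w.

Definition wf_word (w : seq ('I_n * 'I_n * R)) := all (fun t => t.1.1 != t.1.2) w.

Lemma elem_word_cat w1 w2 : elem_word (w1 ++ w2) = elem_word w1 *m elem_word w2.
Proof. by elim: w1 => [|t w1 ih] /=; rewrite ?mul1mx // ih mulmxA. Qed.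

Definition elementary M := exists2 w, wf_word w & M = elem_word w.

Lemma elementary1 : elementary 1%:M. Proof. by exists [::]. Qed.

Lemma elementaryM M N : elementary M -> elementary N -> elementary (M *m N).
Proof.
move=> [w1 h1 ->] [w2 h2 ->]; exists (w1 ++ w2); last by rewrite elem_word_cat.
by rewrite /wf_word all_cat; apply/andP.
Qed.

Lemma elementary_elem i j a : i != j -> elementary (elem i j a).
Proof. by move=> ij; exists [:: (i, j, a)]; rewrite /= ?ij ?mulmx1. Qed.

Lemma elementary_mull i j a M : i != j ->
  elementary (elem i j a *m M) -> elementary M.
Proof.
move=> ij h; rewrite -[M]mul1mx -(elemNK a ij) -mulmxA.
by apply: elementaryM => //; exact: elementary_elem.
Qed.

End Elementary.

Lemma map_elem (R S : comNzRingType) (f : {rmorphism R -> S}) n (i j : 'I_n) a :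
  map_mx f (elem i j a) = elem i j (f a).
Proof.
by apply/matrixP => r s; rewrite mxE !elemE rmorphD rmorphM !rmorph_nat.
Qed.

(** * Generation of SL_n over a local ring by elementary matrices *)

Section SLGeneration.
Variable R : comUnitRingType.
Hypothesis local : forall x y : R, x + y \is a GRing.unit ->
  x \is a GRing.unit \/ y \is a GRing.unit.

Lemma elementary_block n (M : 'M[R]_n) :
  elementary M -> elementary (block_mx (1%:M : 'M[R]_1) 0 0 M).
Proof.
case=> w; elim: w M => [|[[i j] a] w ih] M /=.
  by move=> _ ->; rewrite -scalar_mx_block; exact: elementary1.
move=> /andP[/= ij wf] ->.
have -> : block_mx 1%:M 0 0 (elem i j a *m elem_word w) =
    elem (rshift 1 i) (rshift 1 j) a *m block_mx (1%:M : 'M[R]_1) 0 0 (elem_word w).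
  have -> : elem (rshift 1 i) (rshift 1 j) a = block_mx 1%:M 0 0 (elem i j a).
    rewrite !elem_def [1%:M in LHS]scalar_mx_block.
    rewrite -[delta_mx (rshift 1 i) _]/(delta_mx _ _).
    have -> : delta_mx (rshift 1 i) (rshift 1 j) =
        block_mx 0 0 0 (delta_mx i j) :> 'M[R]_(1 + n).
      apply/matrixP => r s; rewrite !mxE.
      case: (split_ordP r) => r' ->; rewrite !mxE; case: (split_ordP s) => s' ->;
        by rewrite !mxE ?eq_lrshift ?eq_rlshift ?eq_rshift ?andbF.
    by rewrite scale_block_mx add_block_mx !scaler0 !addr0.
  by rewrite mulmx_block !mul1mx !mul0mx !mulmx0 !addr0 !add0r.
apply: elementaryM; last exact: ih.
by apply: elementary_elem; rewrite eq_rshift.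
Qed.

Lemma elementary_ll n (c : 'M[R]_(n, 1)) :
  elementary (block_mx (1%:M : 'M[R]_1) 0 c 1%:M).
Proof.
have addc (c1 c2 : 'M[R]_(n, 1)) : block_mx (1%:M : 'M[R]_1) 0 (c1 + c2) 1%:M =
    block_mx 1%:M 0 c1 1%:M *m block_mx (1%:M : 'M[R]_1) 0 c2 1%:M.
  by rewrite mulmx_block !mul1mx !mulmx1 ?mul0mx !mulmx0 !addr0 ?add0r.
rewrite (matrix_sum_delta c).
apply: (big_ind (fun c : 'M[R]_(n, 1) =>
  elementary (block_mx (1%:M : 'M[R]_1) 0 c (1%:M : 'M[R]_n)))).
- by rewrite -scalar_mx_block; exact: elementary1.
- by move=> c1 c2 h1 h2; rewrite addc; exact: elementaryM.
move=> i _; rewrite big_ord1.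
have -> : block_mx (1%:M : 'M[R]_1) 0 (c i 0 *: delta_mx i 0) 1%:M =
    elem (rshift 1 i) (lshift n 0) (c i 0).
  rewrite !elem_def [1%:M in RHS]scalar_mx_block.
  have -> : delta_mx (rshift 1 i) (lshift n 0) =
      block_mx 0 0 (delta_mx i 0) 0 :> 'M[R]_(1 + n).
    apply/matrixP => r s; rewrite !mxE.
    case: (split_ordP r) => r' ->; rewrite !mxE; case: (split_ordP s) => s' ->;
      by rewrite !mxE ?eq_lrshift ?eq_rlshift ?eq_rshift ?eq_lshift ?andbF.
  by rewrite scale_block_mx add_block_mx !scaler0 !addr0 add0r.
by apply: elementary_elem; rewrite eq_rlshift.
Qed.

Lemma elementary_ur n (c : 'M[R]_(1, n)) :
  elementary (block_mx (1%:M : 'M[R]_1) c 0 1%:M).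
Proof.
have addc (c1 c2 : 'M[R]_(1, n)) : block_mx (1%:M : 'M[R]_1) (c1 + c2) 0 1%:M =
    block_mx 1%:M c1 0 1%:M *m block_mx (1%:M : 'M[R]_1) c2 0 1%:M.
  by rewrite mulmx_block !mul1mx !mulmx1 ?mul0mx !mulmx0 !addr0 ?add0r addrC.
rewrite (matrix_sum_delta c) exchange_big.
apply: (big_ind (fun c : 'M[R]_(1, n) =>
  elementary (block_mx (1%:M : 'M[R]_1) c 0 (1%:M : 'M[R]_n)))).
- by rewrite -scalar_mx_block; exact: elementary1.
- by move=> c1 c2 h1 h2; rewrite addc; exact: elementaryM.
move=> i _; rewrite big_ord1.
have -> : block_mx (1%:M : 'M[R]_1) (c 0 i *: delta_mx 0 i) 0 1%:M =
    elem (lshift n 0) (rshift 1 i) (c 0 i).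
  rewrite !elem_def [1%:M in RHS]scalar_mx_block.
  have -> : delta_mx (lshift n 0) (rshift 1 i) =
      block_mx 0 (delta_mx 0 i) 0 0 :> 'M[R]_(1 + n).
    apply/matrixP => r s; rewrite !mxE.
    case: (split_ordP r) => r' ->; rewrite !mxE; case: (split_ordP s) => s' ->;
      by rewrite !mxE ?eq_lrshift ?eq_rlshift ?eq_rshift ?eq_lshift ?andbF.
  by rewrite scale_block_mx add_block_mx !scaler0 !addr0 add0r.
by apply: elementary_elem; rewrite eq_lrshift.
Qed.

Lemma unit_sum (I : Type) (r : seq I) (F : I -> R) :
  \sum_(i <- r) F i \is a GRing.unit -> exists i, F i \is a GRing.unit.
Proof.
elim: r => [|i r ih]; first by rewrite big_nil unitr0.
by rewrite big_cons => /local[h|/ih //]; exists i.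
Qed.

(** Gaussian elimination, by induction on [n]: row operations bring a 1 to the corner, and clearing
    the first row and column leaves a Schur complement of determinant 1. *)
Lemma SL_elementary n (M : 'M[R]_n) : \det M = 1 -> elementary M.
Proof.
elim: n M => [|n ih] M detM.
  by rewrite [M](_ : _ = 1%:M); [exact: elementary1|apply/matrixP => -[]].
have one00 (N : 'M[R]_(1 + n)) : \det N = 1 -> N 0 0 = 1 -> elementary N.
  move=> detN N00; rewrite -[N]submxK.
  have -> : ulsubmx N = 1%:M.
    by apply/matrixP => i j; rewrite !ord1 !mxE -[RHS]N00; congr (N _ _); apply/val_inj.
  set c := dlsubmx N; set u := ursubmx N; set D := drsubmx N.
  have eN : block_mx (1%:M : 'M[R]_1) u c D = block_mx 1%:M 0 c 1%:M *m
     (block_mx 1%:M 0 0 (D - c *m u) *m block_mx (1%:M : 'M[R]_1) u 0 1%:M).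
    rewrite !mulmx_block !mul1mx !mulmx1 ?mul0mx ?mulmx0 ?mul0mx !addr0 ?add0r.
    by rewrite mulmx1 addrC subrK.
  have eN1 : N = block_mx (1%:M : 'M[R]_1) u c D.
    rewrite -[LHS]submxK; congr block_mx.
    by apply/matrixP => i j; rewrite !ord1 !mxE -[RHS]N00; congr (N _ _); apply/val_inj.
  rewrite eN; apply: elementaryM; first exact: elementary_ll.
  apply: elementaryM; last exact: elementary_ur.
  apply/elementary_block/ih.
  move: detN; rewrite eN1 eN !det_mulmx det_lblock !det1 !mul1r.
  by rewrite det_lblock det_ublock !det1 !mul1r mulr1.
have unit_i (N : 'M[R]_(1 + n)) i : i != 0 -> \det N = 1 ->
    N i 0 \is a GRing.unit -> elementary N.
  move=> i0 detN Ni; have i0' : 0 != i by rewrite eq_sym.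
  apply: (@elementary_mull _ _ 0 i ((1 - N 0 0) / N i 0)) => //.
  apply: one00; first by rewrite det_mulmx det_elem // detN mulr1.
  rewrite !elem_def mulmxDl mul1mx -scalemxAl mxE mxE.
  rewrite [X in _ * X]mxE (bigD1 i) //= mxE !eqxx mul1r big1 ?addr0.
    by rewrite divrK // addrC subrK.
  by move=> j ji; rewrite mxE eqxx (negbTE ji) mul0r.
(* The determinant 1 is a sum of multiples of the entries of the first column; by locality one of
   these is a unit. *)
have [i Mi] : exists i, M i 0 \is a GRing.unit.
  have : \sum_i M i 0 * cofactor M i 0 \is a GRing.unit.
    by rewrite -expand_det_col detM unitr1.
  by move=> /unit_sum[i]; rewrite unitrM => /andP[h _]; exists i.
have [i0|i0] := eqVneq i 0; last exact: (unit_i M i).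
(* The unit is now the corner entry. In size 1 it is the determinant itself; otherwise it serves to
   make the entry below it equal to 1, which reduces to [unit_i]. *)
rewrite {i}i0 in Mi; case: n ih M detM one00 unit_i Mi => [|n] ih M detM one00 unit_i Mi.
  by apply: one00 => //; rewrite -detM det_mx11.
pose one := lift 0 0 : 'I_n.+2.
apply: (@elementary_mull _ _ one 0 ((1 - M one 0) / M 0 0)) => //.
apply: (unit_i _ one) => //; first by rewrite det_mulmx det_elem // detM mulr1.
rewrite !elem_def mulmxDl mul1mx -scalemxAl mxE mxE.
rewrite [X in _ * X]mxE (bigD1 0) //= mxE !eqxx mul1r big1 ?addr0.
  by rewrite divrK // addrC subrK unitr1.
by move=> j ji; rewrite mxE eqxx (negbTE ji) mul0r.
Qed.

End SLGeneration.

(** * The linear step *)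

Section IdealTheory.
Variables (R : comNzRingType) (I : set R).
Hypothesis idI : is_ideal I.

Lemma ideal0 : I 0. Proof. by case: idI. Qed.
Lemma idealD x y : I x -> I y -> I (x + y). Proof. by case: idI => _ + _; exact. Qed.
Lemma idealM a x : I x -> I (a * x). Proof. by case: idI => _ _; exact. Qed.
Lemma ideal_mulr a x : I x -> I (x * a). Proof. by rewrite mulrC; exact: idealM. Qed.
Lemma idealN x : I x -> I (- x). Proof. by rewrite -mulN1r; exact: idealM. Qed.
Lemma idealB x y : I x -> I y -> I (x - y).
Proof. by move=> Ix /idealN; exact: idealD. Qed.
Lemma ideal_sum (T : Type) (r : seq T) (P : pred T) (F : T -> R) :
  (forall i, P i -> I (F i)) -> I (\sum_(i <- r | P i) F i).
Proof. by move=> h; elim/big_ind: _ => //; [exact: ideal0|exact: idealD]. Qed.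
End IdealTheory.

Lemma ideal_unitMl (R : comUnitRingType) (I : set R) (idI : is_ideal I) u x :
  u \is a GRing.unit -> I (u * x) -> I x.
Proof. by move=> uu /(idealM idI u^-1); rewrite mulKr. Qed.

Lemma mul_delta_mxE (R : comNzRingType) n q (i j r : 'I_n) (s : 'I_q)
    (M : 'M[R]_(n, q)) :
  (delta_mx i j *m M) r s = (r == i)%:R * M j s.
Proof.
rewrite mxE (bigD1 j) //= mxE eqxx andbT big1 ?addr0 // => l lj.
by rewrite mxE (negbTE lj) andbF mul0r.
Qed.

Lemma mul_mx_deltaE (R : comNzRingType) n (i j r s : 'I_n) (M : 'M[R]_n) :
  (M *m delta_mx i j) r s = (s == j)%:R * M r i.
Proof.
rewrite mxE (bigD1 i) //= mxE eqxx /= big1 ?addr0 1?mulrC // => l li.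
by rewrite mxE (negbTE li) mulr0.
Qed.

Lemma ord_avoid n (s : seq 'I_n) : (size s < n)%N -> exists l, l \notin s.
Proof.
move=> sn; apply/existsP; apply: contraLR sn => /existsPn h; rewrite -leqNgt.
rewrite -[X in (X <= _)%N]card_ord; apply: leq_trans (card_size s).
by apply/subset_leq_card/fintype.subsetP => i _; have := h i; rewrite negbK.
Qed.

Section LinearStep.
Variables (A : nzRingType) (B : comUnitRingType) (n : nat).
Variable Phi : 'I_n -> 'I_n -> A -> 'M[B]_n.

(** The error term P. The coefficient of the elementary part is the entry (i, j) of [Phi i j a]
    itself, so that P vanishes there. *)
Definition deviation i j a : 'M[B]_n := Phi i j a - elem i j (Phi i j a i j).

Lemma deviation_ij i j a : i != j -> deviation i j a i j = 0.
Proof.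
move=> ij; rewrite /deviation [LHS]mxE [X in _ + X]mxE elemE.
by rewrite (negbTE ij) !eqxx mulr1 add0r subrr.
Qed.

Variables J K : set B.
Hypotheses (idJ : is_ideal J) (idK : is_ideal K).
Hypothesis JJK : forall x y, J x -> J y -> K (x * y).

Hypothesis Phi_comm : forall i j l m a b, i != j -> l != m -> j != l -> i != m ->
  Phi i j a *m Phi l m b = Phi l m b *m Phi i j a.
Hypothesis PhiD : forall i j a b, i != j -> Phi i j (a + b) = Phi i j a *m Phi i j b.
Hypothesis unit1 : forall i j, i != j -> Phi i j 1 i j \is a GRing.unit.
Hypothesis devJ : forall i j a r s, i != j -> J (deviation i j a r s).

Lemma PhiE i j a : Phi i j a = elem i j (Phi i j a i j) + deviation i j a.
Proof. by rewrite /deviation addrC subrK. Qed.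

Let JJmx (M N : 'M[B]_n) r s : (forall r s, J (M r s)) -> (forall r s, J (N r s)) ->
  K ((M *m N) r s).
Proof. by move=> hM hN; rewrite mxE; apply: ideal_sum => // i _; exact: JJK. Qed.

(** The elementary parts commute and the products PQ and QP have entries in [K], so only the terms
    of the commutation relation linear in P or Q are left. In the application [J] and [K] are m^N
    and m^(N+1). *)
Lemma commutator_entry i j l m a c r s :
  i != j -> l != m -> j != l -> i != m ->
  K (Phi i j a i j * ((r == i)%:R * deviation l m c j s
                      - (s == j)%:R * deviation l m c r i)
     + Phi l m c l m * ((s == m)%:R * deviation i j a r l
                      - (r == l)%:R * deviation i j a m s)).
Proof.
move=> ij lm jl im.
have cPQ := Phi_comm a c ij lm jl im; rewrite (PhiE i j) (PhiE l m) in cPQ.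
move: cPQ; set b := Phi i j a i j; set b' := Phi l m c l m.
set P := deviation i j a; set Q := deviation l m c => cPQ.
suff -> : b * ((r == i)%:R * Q j s - (s == j)%:R * Q r i) +
   b' * ((s == m)%:R * P r l - (r == l)%:R * P m s) = (Q *m P) r s - (P *m Q) r s.
  by apply: idealB => //; apply: JJmx => r' s'; exact: devJ.
clearbody P Q b b'.
move: cPQ; rewrite !mulmxDl !mulmxDr (elem_comm b b' jl im).
rewrite -!addrA => /addrI; rewrite !elem_def !mulmxDl !mulmxDr !mulmx1 !mul1mx.
rewrite -!scalemxAl -!scalemxAr => /matrixP/(_ r s).
have mxD (M N : 'M[B]_n) : (M + N) r s = M r s + N r s by rewrite mxE.
have mxZ d (M : 'M[B]_n) : (d *: M) r s = d * M r s by rewrite mxE.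
rewrite !mxD !mxZ !mul_delta_mxE !mul_mx_deltaE !mulrBr.
move: ((P *m Q) r s) ((Q *m P) r s) (b * _) (b * _) (b' * _) (b' * _) (P r s) (Q r s).
move=> u v x y z t p q e.
apply/eqP; rewrite -subr_eq0.
have -> : y - x + (t - z) - (v - u) =
  (q + y + (p + t + u)) - (p + z + (q + x + v)) by ring.
by rewrite e subrr.
Qed.

(** Commute with E_im(1) and read the entry (r, m): a unit times this entry is the only surviving
    term. *)
Lemma dev_col_i i j a r m : i != j -> m != i -> m != j -> r != i ->
  K (deviation i j a r i).
Proof.
move=> ij mi mj ri; have im : i != m by rewrite eq_sym.
have := commutator_entry a 1 r m ij im (_ : j != i) im.
rewrite eq_sym ij (negbTE ri) (negbTE mj) eqxx !mul0r !subr0 mulr0 add0r mul1r.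
by move=> /(_ isT)/(ideal_unitMl idK); apply; exact: unit1.
Qed.

(** Commute with E_lj(1) and read the entry (l, s). *)
Lemma dev_row_j i j a s l : i != j -> l != i -> l != j -> s != j ->
  K (deviation i j a j s).
Proof.
move=> ij li lj sj; have jl : j != l by rewrite eq_sym.
have := commutator_entry a 1 l s ij lj jl ij.
rewrite (negbTE li) (negbTE sj) eqxx !mul0r !sub0r oppr0 mulr0 add0r mul1r mulrN.
by move=> /(idealN idK); rewrite opprK => /(ideal_unitMl idK); apply; exact: unit1.
Qed.

(** Commute with E_sr(1) and read the entry (r, r). *)
Lemma dev_off i j a r s : i != j -> r != i -> r != j -> s != i -> s != j ->
  r != s -> K (deviation i j a r s).
Proof.
move=> ij ri rj si sj rs; have js : j != s by rewrite eq_sym.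
have sr : s != r by rewrite eq_sym.
have ir : i != r by rewrite eq_sym.
have := commutator_entry a 1 r r ij sr js ir.
rewrite (negbTE ri) (negbTE rj) (negbTE rs) eqxx !mul0r subrr mulr0 add0r.
rewrite subr0 mul1r.
by move=> /(ideal_unitMl idK); apply; exact: unit1.
Qed.

(** Away from the entry (i, j), the linear cross terms of the product are multiples of entries (j,
    s) with s <> j and (r, i) with r <> i, already known to be in [K]. *)
Lemma dev_add i j a c r s l : i != j -> l != i -> l != j -> (r, s) != (i, j) ->
  K (deviation i j (a + c) r s - deviation i j a r s - deviation i j c r s).
Proof.
move=> ij li lj rs.
have := PhiD a c ij; rewrite [LHS]PhiE [X in _ = X *m _]PhiE [X in _ = _ *m X]PhiE.
set b := Phi i j a i j; set b' := Phi i j c i j; set b2 := Phi i j (a + c) i j.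
set P := deviation i j a; set Q := deviation i j c; set S := deviation i j _.
have PQ : K ((P *m Q) r s) by apply: JJmx => r' s'; exact: devJ.
have Qj : s != j -> K (Q j s) by exact: (dev_row_j _ ij li lj).
have Pi : r != i -> K (P r i) by exact: (dev_col_i _ ij li lj).
clearbody P Q S b b' b2.
have mxD (M N : 'M[B]_n) : (M + N) r s = M r s + N r s by rewrite mxE.
have mxZ d (M : 'M[B]_n) : (d *: M) r s = d * M r s by rewrite mxE.
have elem_rs d : elem i j d r s = (r == s)%:R.
  by rewrite elemE -xpair_eqE (negbTE rs) mulr0 addr0.
rewrite mulmxDl !mulmxDr -elemD // => /matrixP/(_ r s).
rewrite !mxD !elem_rs !elem_def mulmxDl mul1mx mulmxDr mulmx1.
rewrite -scalemxAl -scalemxAr !mxD !mxZ mul_delta_mxE mul_mx_deltaE -!addrA.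
move: ((P *m Q) r s) PQ => t Kt /addrI ->.
rewrite [X in K X](_ : _ = b * ((r == i)%:R * Q j s) +
  (b' * ((s == j)%:R * P r i) + t)); last by ring.
apply: idealD => //; last apply: idealD => //.
  have [ri|_] := eqVneq r i; last by rewrite mul0r mulr0; exact: ideal0.
  apply: idealM => //; apply: idealM => //; apply: Qj.
  by apply: contraNneq rs => ->; rewrite ri eqxx.
have [sj|_] := eqVneq s j; last by rewrite mul0r mulr0; exact: ideal0.
apply: idealM => //; apply: idealM => //; apply: Pi.
by apply: contraNneq rs => ->; rewrite sj eqxx.
Qed.

(** A diagonal entry is additive modulo [K] and invariant under a -> ta, hence in [K] at every ta -
    a, that is, at every element of A. The entries of row i and column j then follow from further
    commutators. *)
Lemma torus_step : (2 < n)%N ->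
  (forall i j, i != j -> exists2 t, (forall c, exists a, c = t * a - a) &
    forall a r, deviation i j (t * a) r r = deviation i j a r r) ->
  forall i j a r s, i != j -> K (deviation i j a r s).
Proof.
move=> n3 hT.
have third i j : exists2 l : 'I_n, l != i & l != j.
  by have [l] := @ord_avoid n [:: i; j] n3; rewrite !inE negb_or => /andP[]; exists l.
have diag i j a r : i != j -> K (deviation i j a r r).
  move=> ij; have [t tP tE] := hT i j ij; have [l li lj] := third i j.
  have [c ->] := tP a.
  have := @dev_add i j (t * c - c) c r r l ij li lj; rewrite subrK tE.
  move=> h; rewrite -[X in K X]opprK; apply: idealN => //.
  have -> : - deviation i j (t * c - c) r r =
    deviation i j c r r - deviation i j (t * c - c) r r - deviation i j c r r by ring.
  apply: h; apply: contra_neq ij; case=> <- <-; exact: erefl.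
move=> i j a r s ij; have [l li lj] := third i j.
have [<-|rs] := eqVneq r s; first exact: diag.
have [si|si] := eqVneq s i.
  by rewrite si in rs *; exact: (dev_col_i _ ij li lj).
have [rj|rj] := eqVneq r j.
  by rewrite rj in rs *; apply: (dev_row_j _ ij li lj); rewrite eq_sym.
(* Row i: commuting with E_sj(1) at the entry (i, j) gives P_is up to a difference of diagonal
   entries. Column j is handled dually with E_ir(1). *)
have [->|ri] := eqVneq r i.
  have [->|sj] := eqVneq s j; first by rewrite deviation_ij //; exact: ideal0.
  have js : j != s by rewrite eq_sym.
  have := commutator_entry a 1 i j ij sj js ij.
  rewrite !eqxx eq_sym (negbTE si) !mul1r mul0r subr0 addrC => h.
  have h2 := idealM idK (Phi i j a i j) (idealB idK (diag s j 1 j sj) (diag s j 1 i sj)).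
  by have := idealB idK h h2; rewrite addrK => /(ideal_unitMl idK); apply; exact: unit1.
have [->|sj] := eqVneq s j; last exact: (dev_off _ ij).
have ir : i != r by rewrite eq_sym.
have ji : j != i by rewrite eq_sym.
have := commutator_entry a 1 i j ij ir ji ir.
rewrite !eqxx (eq_sym j) (negbTE rj) !mul1r mul0r sub0r addrC mulrN => h.
have h2 := idealM idK (Phi i j a i j) (idealB idK (diag i r 1 j ir) (diag i r 1 i ir)).
have := idealB idK h h2; rewrite addrK => /(idealN idK); rewrite opprK.
by move=> /(ideal_unitMl idK); apply; exact: unit1.
Qed.

(** Only columns i and j of a deviation can be nonzero. Commuting with E_ml(1), for a fourth index
    m, puts the entry (l, j) in [K]; the entries (i, i) and (j, j) come from E_il(1) and E_lj(1),
    since the entry (l, l) is zero. *)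
Lemma column_step : (3 < n)%N ->
  (forall i j a r s, i != j -> s != i -> s != j -> deviation i j a r s = 0) ->
  forall i j a r s, i != j -> K (deviation i j a r s).
Proof.
move=> n4 hC.
have fourth i j l : exists m : 'I_n, [/\ m != i, m != j & m != l].
  have [m] := @ord_avoid n [:: i; j; l] n4; rewrite !inE !negb_or.
  by case/and3P; exists m.
have lj i j a l : i != j -> l != i -> l != j -> K (deviation i j a l j).
  move=> ij li lj; have [m [mi mj ml]] := fourth i j l.
  have jm : j != m by rewrite eq_sym.
  have il : i != l by rewrite eq_sym.
  have jl : j != l by rewrite eq_sym.
  have := commutator_entry a 1 m j ij ml jm il.
  have im : i != m by rewrite eq_sym.
  rewrite (negbTE mi) (negbTE jl) !eqxx (hC m l 1 m i) // !(mul0r, mul1r, sub0r).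
  rewrite oppr0 mulr0 add0r mulrN => /(idealN idK); rewrite opprK.
  by move=> /(ideal_unitMl idK); apply; exact: unit1.
have ii i j a : i != j -> K (deviation i j a i i).
  move=> ij; have [l [li lj' _]] := fourth i j j.
  have il : i != l by rewrite eq_sym.
  have jl : j != l by rewrite eq_sym.
  have ji : j != i by rewrite eq_sym.
  have := commutator_entry a 1 i l ij il ji il.
  rewrite !eqxx (negbTE lj') (hC i j a l l) // !(mul0r, mulr0, subr0, mul1r) => h.
  have h2 := idealM idK (Phi i j a i j) (@lj i l 1 j il ji jl).
  have := idealB idK h h2; rewrite addrC addKr.
  by move=> /(ideal_unitMl idK); apply; exact: unit1.
have jj i j a : i != j -> K (deviation i j a j j).
  move=> ij; have [l [li lj' _]] := fourth i j j.
  have il : i != l by rewrite eq_sym.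
  have jl : j != l by rewrite eq_sym.
  have := commutator_entry a 1 l j ij lj' jl ij.
  rewrite !eqxx (negbTE li) (hC i j a l l) // (hC l j 1 l i) //.
  rewrite !(mul0r, mulr0, subr0, add0r, mul1r, sub0r, oppr0) mulrN.
  by move=> /(idealN idK); rewrite opprK => /(ideal_unitMl idK); apply; exact: unit1.
move=> i j a r s ij.
have [l [li lj' _]] := fourth i j j.
have [->|si] := eqVneq s i.
  have [->|ri] := eqVneq r i; [exact: ii|exact: (dev_col_i _ ij li lj')].
have [->|sj] := eqVneq s j; last by rewrite hC //; exact: ideal0.
have [->|rj] := eqVneq r j; first exact: jj.
have [->|ri] := eqVneq r i; first by rewrite deviation_ij //; exact: ideal0.
exact: lj.
Qed.

End LinearStep.

(** * Elementary systems over a local ring *)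

Lemma ideal_powM (R : comNzRingType) (I : set R) M N x y :
  ideal_pow I M x -> ideal_pow I N y -> ideal_pow I (M + N) (x * y).
Proof.
move=> IMx INy.
have idMN := is_ideal_pow I (M + N).
suff h : (ideal_pow I M `<=` [set x | ideal_pow I (M + N) (x * y)])%classic by exact: h.
apply: smallest_sub.
  split=> [|u v Iu Iv|a u Iu].
  - by rewrite /= mul0r; exact: (ideal0 idMN).
  - by rewrite /= mulrDl; exact: (idealD idMN).
  - by rewrite /= -mulrA; exact: (idealM idMN).
move=> _ [f fI <-] /=; set u := \prod_i f i.
suff h : (ideal_pow I N `<=` [set y | ideal_pow I (M + N) (u * y)])%classic by exact: h.
rewrite {}/u; apply: smallest_sub.
  split=> [|u v Iu Iv|a u Iu].
  - by rewrite /= mulr0; exact: (ideal0 idMN).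
  - by rewrite /= mulrDr; exact: (idealD idMN).
  - by rewrite /= mulrCA; exact: (idealM idMN).
move=> _ [g gI <-] J [_]; apply.
exists (fun i => match fintype.split i with inl i => f i | inr i => g i end).
  by move=> i; case: fintype.split.
rewrite big_split_ord; congr (_ * _); apply: eq_bigr => i _.
  by rewrite -[lshift _ _]/(unsplit (inl _)) unsplitK.
by rewrite -[rshift _ _]/(unsplit (inr _)) unsplitK.
Qed.

Lemma ideal_pow1 (R : comNzRingType) (I : set R) x : I x -> ideal_pow I 1 x.
Proof.
by move=> Ix J [_]; apply; exists (fun=> x) => //; rewrite big_ord1.
Qed.

Lemma ideal_pow0 (R : comNzRingType) (I : set R) x : ideal_pow I 0 x.
Proof.
move=> J [idJ h]; rewrite -[x]mulr1; apply: idealM => //; apply: h.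
by exists (fun=> 0) => [[]|]//; rewrite big_ord0.
Qed.

Section CnlRing.
Variables (p : nat) (p_pr : prime p) (k : finFieldType) (B : cnlRing p_pr k).
Local Notation res := (@cnl_res _ _ _ B).
Definition mpow N : set B := ideal_pow (max_ideal B) N.

Lemma is_ideal_mpow N : is_ideal (mpow N). Proof. exact: is_ideal_pow. Qed.

Lemma max_idealE (x : B) : max_ideal B x <-> res x = 0.
Proof. by split; rewrite /max_ideal /= -cnl_local => /eqP. Qed.

Lemma cnl_unitE (x : B) : (x \is a GRing.unit) = (res x != 0).
Proof. by rewrite cnl_local negbK. Qed.

Lemma cnl_unit_sum (x y : B) : x + y \is a GRing.unit ->
  x \is a GRing.unit \/ y \is a GRing.unit.
Proof.
rewrite !cnl_unitE rmorphD; have [->|] := eqVneq (res x) 0; last by left.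
by rewrite add0r; right.
Qed.

Lemma is_ideal_max : is_ideal (max_ideal B).
Proof.
split=> [|x y|a x]; rewrite !max_idealE; first exact: rmorph0.
  by rewrite rmorphD => -> ->; rewrite addr0.
by rewrite rmorphM => ->; rewrite mulr0.
Qed.

Lemma mpow1 (x : B) : res x = 0 -> mpow 1 x.
Proof. by move=> x0; apply: ideal_pow1; rewrite max_idealE. Qed.

Lemma mpow1_res (x : B) : mpow 1 x -> res x = 0.
Proof.
move=> h; rewrite -max_idealE; apply: h; split; first exact: is_ideal_max.
by move=> _ [f fI <-]; rewrite big_ord1.
Qed.

Lemma mpowS N x : mpow N.+1 x -> mpow N x.
Proof. exact: ideal_pow_sub. Qed.

Lemma mpow_sep x : (forall N, mpow N x) -> x = 0.
Proof.
have [+ _] := cnl_complete B; move=> /seteqP[h _] xN.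
by apply: (h x) => N _; exact: xN.
Qed.

Lemma res_det n (X : 'M[B]_n) : map_mx res X = 1%:M -> X \in unitmx.
Proof.
move=> X1; rewrite unitmxE cnl_unitE -det_map_mx X1 det1; exact: oner_neq0.
Qed.

Lemma res_invmx n (X : 'M[B]_n) : map_mx res X = 1%:M -> map_mx res (invmx X) = 1%:M.
Proof.
move=> X1; have Xu := res_det X1.
by rewrite -[LHS]mulmx1 -[X in _ *m X]X1 -map_mxM mulVmx // map_mx1.
Qed.

End CnlRing.

(** * Elementary systems and the ring morphism they define *)

Section ElementarySystem.
Variables (p : nat) (p_pr : prime p) (k : finFieldType) (A B : cnlRing p_pr k).
Variable n : nat.
Local Notation resA := (@cnl_res _ _ _ A).
Local Notation resB := (@cnl_res _ _ _ B).

(** The Steinberg relations and the prescribed reduction, abstracted from rho so that they survive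
    the change of basis [es_conj]. *)
Record elementary_system (Phi : 'I_n -> 'I_n -> A -> 'M[B]_n) : Prop := {
  es_comm : forall i j l m a b, i != j -> l != m -> j != l -> i != m ->
    Phi i j a *m Phi l m b = Phi l m b *m Phi i j a;
  es_add : forall i j a b, i != j -> Phi i j (a + b) = Phi i j a *m Phi i j b;
  es_commutator : forall i j l a b, i != j -> j != l -> i != l ->
    Phi i j a *m Phi j l b = Phi i l (a * b) *m (Phi j l b *m Phi i j a);
  es_res : forall i j a, i != j -> map_mx resB (Phi i j a) = elem i j (resA a) }.

Lemma es_conj Phi X : map_mx resB X = 1%:M -> elementary_system Phi ->
  elementary_system (fun i j a => invmx X *m Phi i j a *m X).
Proof.
move=> X1 [cm ad ct rs]; have Xu := res_det X1.
have XM M N : invmx X *m M *m X *m (invmx X *m N *m X) = invmx X *m (M *m N) *m X.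
  by rewrite !mulmxA mulmxK.
split=> *; rewrite ?XM.
- by rewrite cm.
- by rewrite ad.
- by rewrite ct.
- by rewrite !map_mxM res_invmx // X1 mul1mx mulmx1 rs.
Qed.

Variable Phi : 'I_n -> 'I_n -> A -> 'M[B]_n.
Hypothesis esPhi : elementary_system Phi.

Lemma es_res_entry i j a r s : i != j ->
  resB (Phi i j a r s) = (r == s)%:R + resA a * ((r == i) && (s == j))%:R.
Proof. by move=> ij; rewrite -elemE -(es_res esPhi) // mxE. Qed.

Lemma es_unit1 i j : i != j -> Phi i j 1 i j \is a GRing.unit.
Proof.
move=> ij; rewrite cnl_unitE es_res_entry // (negbTE ij) add0r !eqxx mulr1 rmorph1.
exact: oner_neq0.
Qed.

Lemma res_deviation i j a r s : i != j -> resB (deviation Phi i j a r s) = 0.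
Proof.
move=> ij; rewrite /deviation [X in resB X]mxE [X in resB (_ + X)]mxE rmorphB es_res_entry //.
rewrite elemE rmorphD rmorphM !rmorph_nat es_res_entry // (negbTE ij) add0r !eqxx.
by rewrite mulr1 subrr.
Qed.

(** Induction on N: the case N = 1 is the condition on reductions, and the powers of m intersect in
    0. *)
Lemma deviation_eq0 : (forall N, (0 < N)%N ->
   (forall i j a r s, i != j -> mpow N (deviation Phi i j a r s)) ->
   forall i j a r s, i != j -> mpow N.+1 (deviation Phi i j a r s)) ->
  forall i j a, i != j -> Phi i j a = elem i j (Phi i j a i j).
Proof.
move=> h.
have hN N i j a r s : i != j -> mpow N.+1 (deviation Phi i j a r s).
  elim: N i j a r s => [|N ih] i j a r s ij; first by apply: mpow1; exact: res_deviation.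
  exact: h.
move=> i j a ij; apply/matrixP => r s; apply/eqP; rewrite -subr_eq0; apply/eqP.
apply: mpow_sep => -[|N]; first exact: ideal_pow0.
by have := hN N i j a r s ij; rewrite /deviation [X in mpow _ X]mxE [X in mpow _ (_ + X)]mxE.
Qed.

Let mpowJK N : (0 < N)%N -> forall x y : B, mpow N x -> mpow N y -> mpow N.+1 (x * y).
Proof.
move=> N0 x y hx hy; have := ideal_powM hx hy.
(* Here N >= 1 gives N + 1 <= 2N. *)
by apply: ideal_pow_sub; rewrite -addn1 leq_add2l.
Qed.

Lemma es_torus : (2 < n)%N ->
  (forall i j, i != j -> exists2 t : A, t - 1 \is a GRing.unit &
    forall a r, Phi i j (t * a) r r = Phi i j a r r) ->
  forall i j a, i != j -> Phi i j a = elem i j (Phi i j a i j).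
Proof.
move=> n3 hT; apply: deviation_eq0 => N N0 hN.
apply: (torus_step (is_ideal_mpow B N.+1) (mpowJK N0)) => //.
- exact: es_comm esPhi.
- exact: es_add esPhi.
- exact: es_unit1.
move=> i j ij; have [t tu tE] := hT i j ij; exists t.
  by move=> c; exists ((t - 1)^-1 * c); rewrite -[X in _ - X]mul1r -mulrBl mulVKr.
move=> a r; rewrite /deviation [LHS]mxE [RHS]mxE tE; congr (_ + _).
rewrite [LHS]mxE [RHS]mxE !elemE; have [->|ri] := eqVneq r i; rewrite /= ?mulr0 //.
by rewrite (negbTE ij) !mulr0.
Qed.

Lemma es_columns : (3 < n)%N ->
  (forall i j a r s, i != j -> s != i -> s != j -> Phi i j a r s = (r == s)%:R) ->
  forall i j a, i != j -> Phi i j a = elem i j (Phi i j a i j).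
Proof.
move=> n3 hC; apply: deviation_eq0 => N N0 hN.
apply: (column_step (is_ideal_mpow B N.+1) (mpowJK N0)) => //.
- exact: es_comm esPhi.
- exact: es_unit1.
move=> i j a r s ij si sj; rewrite /deviation [LHS]mxE [X in _ + X]mxE hC // elemE.
by rewrite (negbTE sj) andbF mulr0 addr0 subrr.
Qed.

Hypothesis n3 : (2 < n)%N.
Hypothesis Phi_elem : forall i j a, i != j -> Phi i j a = elem i j (Phi i j a i j).

Let beta i j a := Phi i j a i j.

Let betaD i j a b : i != j -> beta i j (a + b) = beta i j a + beta i j b.
Proof.
move=> ij; have := es_add esPhi a b ij.
rewrite [LHS]Phi_elem // [X in _ = X *m _]Phi_elem // [X in _ = _ *m X]Phi_elem //.
by rewrite -elemD // => /matrixP/(_ i j); rewrite !elemE (negbTE ij) !add0r !eqxx !mulr1.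
Qed.

Let betaM i j l a b : i != j -> j != l -> i != l ->
  beta i l (a * b) = beta i j a * beta j l b.
Proof.
move=> ij jl il; have := es_commutator esPhi a b ij jl il.
rewrite -/(beta _ _ _) (Phi_elem a ij) (Phi_elem b jl) (Phi_elem (a * b) il).
rewrite elem_commutator //.
set N := elem j l _ *m _ => /(congr1 (mulmx^~ (invmx N))).
rewrite !mulmxK; last 2 first.
- by rewrite unitmxE det_mulmx !det_elem // mulr1 unitr1.
- by rewrite unitmxE det_mulmx !det_elem // mulr1 unitr1.
by move=> /matrixP/(_ i l); rewrite !elemE (negbTE il) !add0r !eqxx !mulr1.
Qed.

(** Rescaling by u makes every coefficient at a = 1 equal to 1. The law g_il(ab) = g_ij(a) g_jl(b),
    with a or b equal to 1, then shows that g_ij does not depend on (i, j), so the common function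
    is multiplicative. *)
Lemma elementary_form_morphism : exists (u : 'I_n -> B) (f : A -> B),
  [/\ forall i, resB (u i) = 1, forall a, resB (f a) = resA a,
      [/\ f 1 = 1, {morph f : a b / a + b} & {morph f : a b / a * b}] &
      forall i j a, i != j -> Phi i j a = elem i j ((u i)^-1 * f a * u j)].
Proof.
pose o : 'I_n := Ordinal (ltn_trans (isT : 0 < 2)%N n3).
pose o' : 'I_n := Ordinal (ltn_trans (isT : 1 < 2)%N n3).
have oo' : o != o' by [].
have third i j : exists2 l : 'I_n, l != i & l != j.
  by have [l] := @ord_avoid n [:: i; j] n3; rewrite !inE negb_or => /andP[]; exists l.
pose u j := if j == o then 1 else beta o j 1.
have resu j : resB (u j) = 1.
  rewrite /u; case: eqVneq => [_|jo]; first exact: rmorph1.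
  by rewrite /beta es_res_entry eq_sym // (negbTE jo) add0r !eqxx mulr1 rmorph1.
have uu j : u j \is a GRing.unit by rewrite cnl_unitE resu oner_neq0.
pose g i j a := u i * beta i j a / u j.
have gM i j l a b : i != j -> j != l -> i != l -> g i l (a * b) = g i j a * g j l b.
  move=> ij jl il; rewrite /g (betaM a b ij jl il) !mulrA; congr (_ / _).
  by rewrite divrK ?uu.
have go j : j != o -> g o j 1 = 1.
  by move=> jo; rewrite /g /u eqxx mul1r (negbTE jo) divrr // es_unit1 // eq_sym.
have gij i j : i != j -> i != o -> j != o -> g i j 1 = 1.
  move=> ij io jo; have oi : o != i by rewrite eq_sym.
  have oj : o != j by rewrite eq_sym.
  by have := gM o i j 1 1 oi ij oj; rewrite mul1r !go // mul1r => ->.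
have gio i : i != o -> g i o 1 = 1.
  move=> io; have [j jo ji] := third o i; have oj : o != j by rewrite eq_sym.
  have ij : i != j by rewrite eq_sym.
  by have := gM i o j 1 1 io oj ij; rewrite mul1r gij // go // mulr1 => ->.
have g1 i j : i != j -> g i j 1 = 1.
  have [->|io] := eqVneq i o; first by rewrite eq_sym; exact: go.
  have [-> _|jo ij] := eqVneq j o; first exact: gio.
  exact: gij.
have gr i j l a : i != j -> i != l -> g i j a = g i l a.
  move=> ij il; have [->//|jl] := eqVneq j l.
  by have := gM i j l a 1 ij jl il; rewrite mulr1 g1 // mulr1.
have gl i j l a : i != l -> j != l -> g i l a = g j l a.
  move=> il jl; have [->//|ij] := eqVneq i j.
  by have := gM i j l 1 a ij jl il; rewrite mul1r g1 // mul1r.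
(* The indices are moved one at a time. A pair (i, o) needs a detour through a third index, since
   (o, o) is excluded. *)
have gE i j a : i != j -> g i j a = g o o' a.
  have [->|io] := eqVneq i o; first by move=> oj; exact: gr.
  have [-> _|jo ij] := eqVneq j o.
    have [l lo li] := third o i; rewrite (gr i o l) // 1?eq_sym //.
    by rewrite (gl i o l) 1?eq_sym //; apply: gr; rewrite // eq_sym.
  by rewrite (gl i o j) // 1?eq_sym //; apply: gr; rewrite // eq_sym.
exists u, (g o o'); split=> //.
- move=> a; rewrite /g !rmorphM rmorphV // !resu invr1 mulr1 mul1r.
  by rewrite /beta es_res_entry // (negbTE oo') add0r !eqxx mulr1.
- split=> [|a b|a b]; first exact: g1.
    by rewrite /g betaD // mulrDr mulrDl.
  have [l lo lo'] := third o o'; have ol : o != l by rewrite eq_sym.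
  by rewrite (gM o l o') // (gE o l) // (gE l o').
move=> i j a ij; rewrite Phi_elem // -(gE i j) //.
by rewrite /g !mulrA mulVr // mul1r divrK.
Qed.

End ElementarySystem.

(** * Witt vectors *)

Section GhostCongruence.
Variables (p : nat) (p_pr : prime p) (T : comNzRingType).
Hypothesis p_reg : forall x : T, x *+ p = 0 -> x = 0.

(** By induction, congruences modulo p between earlier coordinates become congruences modulo p^(n+1)
    between the terms p^i x_i^(p^(n-i)). Hence p^n a_n and p^n b_n agree modulo p^(n+1), and p is
    regular. *)
Lemma ghost_cong (a b : nat -> T) :
  (forall n, cong (p ^ n.+1) (ghost p a n) (ghost p b n)) ->
  forall n, cong p (a n) (b n).
Proof.
have p_regX n (x : T) : x *+ p ^ n = 0 -> x = 0.
  by elim: n x => [|n ih] x; rewrite ?expn0 // expnS mulrnA => /ih/p_reg.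
move=> gab n; elim/ltn_ind: n => n ih.
have [z] := gab n; rewrite !ghostS.
have [y ->] : cong (p ^ n.+1) (\sum_(i < n) a i ^+ (p ^ (n - i)) *+ (p ^ i))
   (\sum_(i < n) b i ^+ (p ^ (n - i)) *+ (p ^ i)).
  apply: cong_sum => i _.
  have -> : (p ^ n.+1 = p ^ (n - i).+1 * p ^ i)%N.
    by rewrite -expnD addSn subnK // ltnW.
  by apply: cong_mulrn; apply: congXpn => //; exact: ih.
rewrite -!addrA => /addrI e; exists (z - y); apply/eqP; rewrite -subr_eq0.
apply/eqP/(p_regX n); rewrite !(mulrnBl, mulrnDl) -!mulrnA.
have -> : a n *+ p ^ n = b n *+ p ^ n + z *+ p ^ n.+1 - y *+ p ^ n.+1.
  by rewrite -e addrAC subrr add0r.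
rewrite -expnS; move: (b n *+ _) (z *+ _) (y *+ _) => b' z' y'; ring.
Qed.
End GhostCongruence.

Section WittCharP.
Import ZPoly.
Variables (p : nat) (p_pr : prime p).

Lemma zpoly_reg (x : zpoly) : x *+ p = 0 -> x = 0.
Proof. exact/mulrn_eq0/prime_gt0. Qed.

(* Verschiebung composed with Frobenius. *)
Definition ver_frob (R : comNzRingType) (x : nat -> R) (n : nat) : R :=
  if n is m.+1 then x m ^+ p else 0.

Lemma ghost_mulrn (R : comNzRingType) (x : witt p_pr R) m n :
  ghost p (witt_coord (x *+ m)) n = ghost p (witt_coord x) n *+ m.
Proof.
elim: m => [|m ih]; first by rewrite !mulr0n; exact: ghost_zero.
by rewrite !mulrS -ih; exact: ghost_add.
Qed.

(** Multiplication by p turns p^i x_i^(p^(n-i)), for i < n, into the term of index i + 1 for the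
    shifted vector of p-th powers; the term i = n is left over. *)
Lemma ghost_ver_frob (R : comNzRingType) (x : nat -> R) n :
  ghost p x n *+ p = ghost p (ver_frob x) n + x n *+ p ^ n.+1.
Proof.
rewrite ghostS /ghost big_ord_recl /= expr0n.
rewrite expn_eq0 eqn0Ngt prime_gt0 //= mul0rn add0r mulrnDl -mulrnA -expnSr.
congr (_ + _); rewrite -sumrMnl; apply: eq_bigr => i _.
by rewrite /bump /= add1n add0n -exprM -expnS subnSK // -mulrnA -expnSr.
Qed.

Lemma mulp_ver_frob_zpoly n :
  cong p (witt_coord (Witt p_pr (X 0) *+ p) n) (ver_frob (X 0) n).
Proof.
apply: (ghost_cong p_pr zpoly_reg) => {}n; rewrite ghost_mulrn.
by exists (X 0 n); exact: ghost_ver_frob.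
Qed.

(** Over [zpoly] the two sides have ghost components congruent modulo p^(n+1), hence coordinates
    congruent modulo p. Specializing to the coordinates of [w] kills the difference, as p = 0 in
    k. *)
Lemma mulp_witt (k : comNzRingType) (w : witt p_pr k) : p%:R = 0 :> k ->
  forall n, witt_coord (w *+ p) n = ver_frob (witt_coord w) n.
Proof.
move=> pk n; pose f := ZPoly.eval (fun=> witt_coord w) : {rmorphism zpoly -> k}.
have fX : f \o X 0 = witt_coord w by apply/funext => i; exact: evalX.
have fm m : f \o witt_coord (Witt p_pr (X 0) *+ m) = witt_coord (w *+ m).
  elim: m => [|m ih]; first by rewrite !mulr0n; exact: map_witt_zero.
  rewrite !mulrS; set y := _ *+ m in ih *.
  by apply: etrans (map_witt_add p_pr f (X 0) (witt_coord y)) _; rewrite fX ih.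
rewrite -fm /=; have [z ->] := mulp_ver_frob_zpoly n.
rewrite rmorphD rmorphMn -mulr_natr pk mulr0 addr0 -[X in _ = ver_frob X n]fX.
by case: n => [|n] /=; [exact: (rmorph0 f)|exact: (rmorphXn f)].
Qed.

Definition teichmuller (R : comNzRingType) (x : R) : witt p_pr R :=
  Witt p_pr (fun n => if n is 0 then x else 0).

Lemma ghost_teichmuller (R : comNzRingType) (x : R) n :
  ghost p (witt_coord (teichmuller x)) n = x ^+ (p ^ n).
Proof.
rewrite /ghost big_ord_recl /= subn0 expn0 mulr1n big1 ?addr0 // => i _.
by rewrite expr0n expn_eq0 eqn0Ngt prime_gt0 //= mul0rn.
Qed.

(** Over the torsion-free ring [zpoly] both sides have the same ghost components; the general case
    is a specialization. *)
Lemma teichmullerM (R : comNzRingType) (x y : R) :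
  teichmuller (x * y) = teichmuller x * teichmuller y.
Proof.
pose v := witt_env (fun=> x) (fun=> y).
pose f := ZPoly.eval v : {rmorphism zpoly -> R}.
have ft z : f \o witt_coord (teichmuller z) = witt_coord (teichmuller (f z)).
  by apply/funext => -[|n] /=; rewrite ?rmorph0.
have e : witt_coord (teichmuller (X 0 0 * X 1 0)) =
    witt_mul p_pr (witt_coord (teichmuller (X 0 0))) (witt_coord (teichmuller (X 1 0))).
  apply/funext/(ghost_inj zpoly_reg) => n.
  by rewrite ghost_mul !ghost_teichmuller exprMn.
congr Witt; have := congr1 (comp f) e; rewrite map_witt_mul !ft rmorphM.
have -> : f (X 0 0) = x by exact: evalX.
by have -> : f (X 1 0) = y by exact: evalX.
Qed.

Lemma teichmuller1 (R : comNzRingType) : teichmuller (1 : R) = 1.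
Proof. by congr Witt; apply/funext => -[]. Qed.

End WittCharP.

(** * Maps from W(k) are determined by their reduction *)

Section WittMorphisms.
Variables (p : nat) (p_pr : prime p) (k : finFieldType).
Hypothesis charkp : p \in [pchar k].

Lemma frobenius_surj (x : k) : exists y, y ^+ p = x.
Proof.
have inj : injective (fun y : k => y ^+ p).
  by move=> y z /= /(fmorph_inj (pFrobenius_aut charkp)).
by exists (invF inj x); exact: (f_invF inj).
Qed.

(** Multiplication by p is Verschiebung composed with Frobenius, and k is perfect: v is made of the
    p-th roots of the shifted coordinates. *)
Lemma witt_mulp (w : witt p_pr k) : witt_coord w 0 = 0 -> exists v, w = v *+ p.
Proof.
move=> w0; have [y yP] := choice (fun n => frobenius_surj (witt_coord w n.+1)).
exists (Witt p_pr y); have pk : p%:R = 0 :> k by exact: pcharf0.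
have := mulp_witt (Witt p_pr y) pk; case: w w0 yP => w /= w0 yP.
move: (_ *+ p) => [v] /= vE; congr Witt; apply/funext => n; rewrite vE.
by case: n => [|n] //=; rewrite yP.
Qed.

Lemma cnl_p (B : cnlRing p_pr k) : @cnl_res _ _ _ B p%:R = 0.
Proof. by rewrite rmorph_nat; exact: pcharf0. Qed.

(** The cofactor of a - b in a^p - b^p reduces to p b^(p-1) = 0, so it lies in m. *)
Lemma mpow_expp (B : cnlRing p_pr k) N (a b : B) : @cnl_res _ _ _ B a = @cnl_res _ _ _ B b ->
  mpow N (a - b) -> mpow N.+1 (a ^+ p - b ^+ p).
Proof.
move=> rab hab; rewrite subrXX -addn1; apply: ideal_powM => //; apply: mpow1.
rewrite rmorph_sum (eq_bigr (fun=> @cnl_res _ _ _ B b ^+ p.-1)).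
  by rewrite sumr_const card_ord -mulr_natr pcharf0 ?mulr0.
move=> i _; rewrite rmorphM !rmorphXn /= rab -exprD; congr (_ ^+ _).
by rewrite subnK // -ltnS prednK ?prime_gt0 // ltn_ord.
Qed.

(** Write w = u^p + pv. If f and g agree modulo m^N, they agree modulo m^(N+1) on u^p by
    [mpow_expp], and on pv because p is in m. *)
Lemma witt_morphism_unique (B : cnlRing p_pr k) (f g : {rmorphism witt p_pr k -> B}) :
  (forall w, @cnl_res _ _ _ B (f w) = witt_coord w 0) ->
  (forall w, @cnl_res _ _ _ B (g w) = witt_coord w 0) -> f =1 g.
Proof.
move=> rf rg w; apply/eqP; rewrite -subr_eq0; apply/eqP/mpow_sep => -[|N].
  exact: ideal_pow0.
elim: N w => [|N ih] w.
  by apply: mpow1; rewrite rmorphB rf rg subrr.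
have [y yp] := frobenius_surj (witt_coord w 0).
(* Only coordinate 0 of [u] matters, so a constant sequence will do. *)
pose u := Witt p_pr (fun=> y).
have [v vE] : exists v, w - u ^+ p = v *+ p.
  (* Coordinate 0 of the difference is computed through the ring morphism [f] followed by
     reduction. *)
  apply: witt_mulp; rewrite -rf rmorphB rmorphXn rmorphB rmorphXn /= !rf /= yp.
  by rewrite subrr.
have -> : w = u ^+ p + v *+ p by rewrite -vE addrC subrK.
rewrite !rmorphD !rmorphMn !rmorphXn /=.
have -> : f u ^+ p + f v *+ p - (g u ^+ p + g v *+ p) =
  (f u ^+ p - g u ^+ p) + (f v - g v) * p%:R.
  rewrite -[f v *+ p]mulr_natr -[g v *+ p]mulr_natr.
  by move: (f u ^+ p) (g u ^+ p) (f v) (g v) p%:R => a b c d e; ring.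
apply: (idealD (is_ideal_mpow _ _)); first by apply: mpow_expp; [rewrite rf rg|exact: ih].
by rewrite -[N.+2]addn1; apply: ideal_powM; [exact: ih|by apply: mpow1; exact: cnl_p].
Qed.

(** The two maps W(k) -> B, through A and directly, have the same reduction, so
    [witt_morphism_unique] gives W(k)-linearity. *)
Lemma cnl_lrmorphism (A B : cnlRing p_pr k) (f : A -> B) :
  (forall a, @cnl_res _ _ _ B (f a) = @cnl_res _ _ _ A a) -> f 1 = 1 ->
  {morph f : a b / a + b} -> {morph f : a b / a * b} ->
  exists g : {lrmorphism A -> B}, g =1 f.
Proof.
move=> rf f1 fD fM.
have fN a : f (- a) = - f a.
  apply/eqP; rewrite -addr_eq0 -fD addNr; apply/eqP.
  by apply: (addrI (f 0)); rewrite -fD !addr0.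
have fB : zmod_morphism f by move=> a b; rewrite fD fN.
pose m1 := GRing.isZmodMorphism.Build A B f fB.
pose m2 := GRing.isMonoidMorphism.Build A B f (f1, fM).
pose g : {rmorphism A -> B} := HB.pack f m1 m2.
have fZ : scalable f.
  move=> w a; rewrite -[w *: a]mulr_algl -[w *: f a]mulr_algl fM; congr (_ * _).
  pose h1 : {rmorphism witt p_pr k -> B} := g \o in_alg A.
  pose h2 : {rmorphism witt p_pr k -> B} := in_alg B.
  apply: (@witt_morphism_unique B h1 h2) => {}w /=.
    by rewrite rf cnl_res_scalar.
  by rewrite cnl_res_scalar.
pose m3 := GRing.isScalable.Build (witt p_pr k) A B *:%R f fZ.
pose g' : {lrmorphism A -> B} := HB.pack f m1 m2 m3.
by exists g'.
Qed.

End WittMorphisms.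

(** * Elements of order three *)

Section OrderThree.
Variables (R : comNzRingType) (n : nat).

(** On the span of e_i and e_j this has determinant 1 and, thanks to the entry -3, trace -1; there
    it satisfies X^2 + X + 1 = 0 and has cube 1. *)
Definition rot3 (i j : 'I_n) : 'M[R]_n := elem i j 1 *m elem j i (- 3).

Definition plane_mx (i j : 'I_n) : 'M[R]_n := delta_mx i i + delta_mx j j.

Lemma rot3E (i j : 'I_n) : i != j ->
  rot3 i j = 1%:M + (delta_mx i j - 3 *: delta_mx j i - 3 *: delta_mx i i).
Proof.
move=> ij; rewrite /rot3 elem_mul eqxx mulr1n mul1r elem_def scale1r !scaleNr.
by rewrite -!addrA.
Qed.

(** The polynomial 1 + X + X^2 is 0 on the coordinate plane and 3 on the other basis vectors, which
    are fixed. *)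
Lemma sum_rot3 i j : i != j ->
  1%:M + rot3 i j + rot3 i j *m rot3 i j = 3 *: (1%:M - plane_mx i j).
Proof.
move=> ij; rewrite rot3E // /plane_mx.
rewrite !mulmxDl !mulmxDr !mul1mx !mulmx1 !mulNmx !mulmxN -!scalemxAl -!scalemxAr.
rewrite !mul_delta_mx_cond !eqxx (eq_sym j) (negbTE ij) !mulr0n !mulr1n !scaler0.
apply/matrixP => r s; rewrite !mxE.
move: ((r == i) && (s == j)) ((r == j) && (s == i)) ((r == i) && (s == i))
 ((r == j) && (s == j)) (r == s) => a b c d e.
move: (a%:R) (b%:R) (c%:R) (d%:R) (e%:R) => {}a {}b {}c {}d {}e.
ring.
Qed.

Lemma rot3_cube i j : i != j -> rot3 i j *m rot3 i j *m rot3 i j = 1%:M.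
Proof.
move=> ij; apply/eqP; rewrite -subr_eq0; apply/eqP.
have -> : rot3 i j *m rot3 i j *m rot3 i j - 1%:M =
   (rot3 i j - 1%:M) *m (1%:M + rot3 i j + rot3 i j *m rot3 i j).
  move: (rot3 i j) => C; rewrite mulmxBl mul1mx !mulmxDr mulmx1 !mulmxA.
  move: (C *m C *m C) (C *m C) => C3 C2.
  by rewrite [C + C2]addrC -addrA [RHS]addrC; apply/matrixP => r s; rewrite !mxE; ring.
rewrite sum_rot3 // -scalemxAr [rot3 i j](rot3E ij) addrC addKr.
rewrite mulmxBr mulmx1 /plane_mx mulmxDr !mulmxBl -!scalemxAl !mul_delta_mx_cond.
rewrite !eqxx (negbTE ij) (eq_sym j) (negbTE ij) !mulr0n !mulr1n !scaler0.
by apply/matrixP => r s; rewrite !mxE; ring.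
Qed.

End OrderThree.
Arguments rot3 {R n}.
Arguments plane_mx {R n}.

(** * Planes cut out by elements of order three, and a basis adapted to them *)

Section Fixing.
Variables (p : nat) (p_pr : prime p) (k : finFieldType) (A B : cnlRing p_pr k).
Variable n : nat.
Local Notation resA := (@cnl_res _ _ _ A).
Local Notation resB := (@cnl_res _ _ _ B).
Variable Phi : 'I_n -> 'I_n -> A -> 'M[B]_n.
Hypothesis esPhi : elementary_system Phi.

Definition rotation i j := Phi i j 1 *m Phi j i (- 3).

Hypothesis rotation_cube : forall i j, i != j ->
  rotation i j *m rotation i j *m rotation i j = 1%:M.
Hypothesis three_neq0 : (3 : k) != 0.

Definition rotation_sum i j := 1%:M + rotation i j + rotation i j *m rotation i j.
(** A third of [rotation_sum] projects onto the vectors fixed by the rotation. This is the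
    complementary projection, with image V_ij. *)
Definition plane i j := 1%:M - (3 : B)^-1 *: rotation_sum i j.

Lemma three_unit : (3 : B) \is a GRing.unit.
Proof. by rewrite cnl_unitE rmorph_nat. Qed.

Let three_sum : 3 = 1 + 1 + 1 :> B. Proof. by rewrite !mulrS mulr0n addr0 addrA. Qed.

Lemma rotation_sum_mul i j (M : 'M[B]_n) :
  M *m rotation i j = M -> M *m rotation_sum i j = (3 : B) *: M.
Proof.
rewrite /rotation_sum; move: (rotation i j) => w e.
by rewrite !mulmxDr mulmx1 mulmxA !e three_sum !scalerDl !scale1r.
Qed.

Lemma rotation_sum_mull i j (M : 'M[B]_n) :
  rotation i j *m M = M -> rotation_sum i j *m M = (3 : B) *: M.
Proof.
rewrite /rotation_sum; move: (rotation i j) => w e.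
by rewrite !mulmxDl mul1mx -mulmxA !e three_sum !scalerDl !scale1r.
Qed.

Lemma plane_idem i j : i != j -> plane i j *m plane i j = plane i j.
Proof.
move=> ij; have su : rotation_sum i j *m rotation i j = rotation_sum i j.
  by rewrite /rotation_sum !mulmxDl mul1mx rotation_cube // addrC addrA.
rewrite {2}/plane mulmxBr mulmx1 -[RHS]subr0; congr (_ - _).
rewrite /plane mulmxBl mul1mx -scalemxAr -scalemxAl (rotation_sum_mul su).
by rewrite [3^-1 *: (3 *: _)]scalerA mulVr ?three_unit // scale1r subrr.
Qed.

Lemma comm_rotation_sum i j (M : 'M[B]_n) :
  rotation i j *m M = M *m rotation i j -> rotation_sum i j *m M = M *m rotation_sum i j.
Proof.
rewrite /rotation_sum; move: (rotation i j) => w e.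
by rewrite !mulmxDl !mulmxDr mul1mx mulmx1 -mulmxA !e !mulmxA e.
Qed.

Lemma comm_plane i j (M : 'M[B]_n) :
  rotation i j *m M = M *m rotation i j -> plane i j *m M = M *m plane i j.
Proof.
move=> e; rewrite /plane mulmxBl mulmxBr mul1mx mulmx1 -scalemxAl -scalemxAr.
by rewrite comm_rotation_sum.
Qed.

Lemma res_rotation i j : i != j -> map_mx resB (rotation i j) = rot3 i j.
Proof.
move=> ij; rewrite map_mxM !(es_res esPhi) // 1?eq_sym //.
by rewrite rmorph1 rmorphN rmorph_nat.
Qed.

Lemma res_plane i j : i != j -> map_mx resB (plane i j) = plane_mx i j.
Proof.
move=> ij; rewrite /plane /rotation_sum; move: (rotation i j) (res_rotation ij) => w rw.
rewrite map_mxB map_mx1 map_mxZ !map_mxD map_mx1 map_mxM rw sum_rot3 //.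
rewrite rmorphV ?three_unit // rmorph_nat scalerA.
by rewrite mulVf // scale1r opprB addrC subrK.
Qed.

Lemma res_det_unit (M : 'M[B]_n) : \det (map_mx resB M) != 0 -> M \in unitmx.
Proof. by move=> h; rewrite unitmxE cnl_unitE -det_map_mx. Qed.

(** As 1 + v + v^2 reduces to 3 it is invertible, and it kills v - 1. This is the absence of
    3-torsion in the kernel of reduction. *)
Lemma cube_eq1 (v : 'M[B]_n) : map_mx resB v = 1%:M -> v *m v *m v = 1%:M -> v = 1%:M.
Proof.
move=> rv v3; pose w := 1%:M + v + v *m v.
have wu : w \in unitmx.
  apply: res_det_unit; rewrite /w !map_mxD map_mxM rv mulmx1 map_mx1.
  rewrite -scalemx1 -!scalerDl scalemx1 det_scalar expf_neq0 // -addrA.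
  exact: three_neq0.
have : (v - 1%:M) *m w = 0.
  rewrite mulmxBl mul1mx; apply/eqP; rewrite subr_eq0; apply/eqP.
  by rewrite /w !mulmxDr mulmx1 mulmxA v3 addrC addrA.
move=> /(congr1 (mulmx^~ (invmx w))) /=; rewrite mulmxK // mul0mx.
exact: subr0_eq.
Qed.

Lemma Phi_unit i j a : i != j -> Phi i j a \in unitmx.
Proof.
by move=> ij; apply: res_det_unit; rewrite (es_res esPhi) // det_elem // oner_neq0.
Qed.

Definition away (i j l m : 'I_n) := [&& l != i, l != j, m != i & m != j].

Lemma comm_rotation i j l m a : i != j -> l != m -> away i j l m ->
  rotation i j *m Phi l m a = Phi l m a *m rotation i j.
Proof.
move=> ij lm /and4P[li lj mi mj]; have ji : j != i by rewrite eq_sym.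
rewrite /rotation -mulmxA (es_comm esPhi _ _ ji lm) 1?eq_sym // !mulmxA.
by rewrite (es_comm esPhi _ _ ij lm) // eq_sym.
Qed.

Lemma away_sym i j l m : away i j l m -> away i j m l.
Proof. by case/and4P => *; apply/and4P. Qed.

(** The rotation in {l, m} commutes with the projection onto V_ij. Its restriction to V_ij, extended
    by the identity on the complement, is a matrix [v] of cube 1 reducing to 1, so [cube_eq1]
    applies. *)
Lemma rotation_plane i j l m : i != j -> l != m -> away i j l m ->
  rotation l m *m plane i j = plane i j.
Proof.
move=> ij lm aw; have ml : m != l by rewrite eq_sym.
have cu : rotation i j *m rotation l m = rotation l m *m rotation i j.
  rewrite [rotation l m]/rotation mulmxA (comm_rotation 1 ij lm aw) -[LHS]mulmxA.
  by rewrite (comm_rotation (- 3) ij ml (away_sym aw)) mulmxA.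
have cp := comm_plane cu; have pp := plane_idem ij.
move: (rotation l m) (plane i j) (rotation_cube lm) (res_rotation lm) (res_plane ij) cp pp {cu} =>
  w P w3 rw rP cp pp.
have wP : w *m P *m (w *m P) = w *m w *m P by rewrite -mulmxA (mulmxA P) cp -(mulmxA w P) pp mulmxA.
have PQ : P *m (1%:M - P) = 0 by rewrite mulmxBr mulmx1 pp subrr.
have QwP : (1%:M - P) *m (w *m P) = 0.
  by rewrite mulmxBl mul1mx mulmxA cp -(mulmxA w P) pp subrr.
have QQ : (1%:M - P) *m (1%:M - P) = 1%:M - P by rewrite mulmxBl mul1mx PQ subr0.
have rQ : map_mx resB (1%:M - P) = 1%:M - plane_mx i j by rewrite map_mxB map_mx1 rP.
move: (1%:M - P) PQ QwP QQ (subrK P 1%:M) rQ => Q PQ QwP QQ QE rQ.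
pose v := w *m P + Q.
have vv : v *m v = w *m w *m P + Q.
  by rewrite /v mulmxDl !mulmxDr wP QwP QQ -(mulmxA w P) PQ mulmx0 addr0 add0r.
have v3 : v *m v *m v = 1%:M.
  rewrite vv /v mulmxDl !mulmxDr QwP QQ -(mulmxA (w *m w) P Q) PQ mulmx0 addr0 add0r.
  have -> : w *m w *m P *m (w *m P) = w *m w *m w *m P.
    by rewrite -!mulmxA (mulmxA P) cp -(mulmxA w P) pp !mulmxA.
  by rewrite w3 mul1mx addrC.
have rv : map_mx resB v = 1%:M.
  rewrite /v map_mxD map_mxM rw rP rQ.
  suff -> : rot3 l m *m plane_mx i j = plane_mx i j :> 'M[k]_n by rewrite addrC subrK.
  rewrite rot3E // mulmxDl mul1mx /plane_mx !mulmxDr !mulmxBl -!scalemxAl.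
  case/and4P: aw => li lj mi mj.
  rewrite !mul_delta_mx_cond (negbTE li) (negbTE lj) (negbTE mi) (negbTE mj).
  by rewrite !mulr0n !scaler0 !subr0 !addr0.
by have := cube_eq1 rv v3; rewrite /v addrC -QE => /addrI.
Qed.

Lemma plane_plane i j l m : i != j -> l != m -> away i j l m ->
  plane l m *m plane i j = 0.
Proof.
move=> ij lm aw; rewrite {1}/plane mulmxBl mul1mx -scalemxAl.
rewrite (rotation_sum_mull (rotation_plane ij lm aw)) scalerA mulVr ?three_unit //.
by rewrite scale1r subrr.
Qed.

Hypothesis n5 : (4 < n)%N.

(** With a fifth index r, the rotation w in {l, r} satisfies w E_rm(a) = E_lm(a) E_rm(a) w. As w is
    the identity on V_ij and E_rm(a) commutes with the projection, E_lm(a) is the identity on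
    V_ij. *)
Lemma Phi_plane i j l m a : i != j -> l != m -> away i j l m ->
  Phi l m a *m plane i j = plane i j.
Proof.
move=> ij lm aw; have [r] := @ord_avoid n [:: i; j; l; m] n5.
rewrite !inE !negb_or => /and4P[ri rj rl rm].
case/and4P: (aw) => li lj mi mj.
have lr : l != r by rewrite eq_sym.
have mr : m != r by rewrite eq_sym.
have awr : away i j r m by apply/and4P.
have awl : away i j l r by apply/and4P.
have e : rotation l r *m Phi r m a = Phi l m a *m Phi r m a *m rotation l r.
  rewrite /rotation -mulmxA (es_comm esPhi _ _ rl rm) // mulmxA.
  by rewrite (es_commutator esPhi 1 a lr rm lm) mul1r !mulmxA.
have cP := comm_plane (comm_rotation a ij rm awr).
move: (rotation l r) (plane i j) e (rotation_plane ij lr awl) cP => w P e wP cP.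
have := congr1 (mulmx^~ P) e; rewrite /= -!mulmxA wP -cP (mulmxA w) wP (mulmxA (Phi l m a)).
by move=> /(congr1 (mulmx^~ (invmx (Phi r m a)))); rewrite /= !mulmxK ?Phi_unit.
Qed.

(** Here z = (1 - [plane i j]) z, and rows i and j of 1 - [plane i j] vanish modulo m, which gains
    one power. *)
Lemma plane_entry N i j r (z : 'cV[B]_n) : i != j -> r \in [:: i; j] ->
  plane i j *m z = 0 -> (forall s, mpow N (z s 0)) -> mpow N.+1 (z r 0).
Proof.
move=> ij rij Pz hz.
have -> : z r 0 = \sum_s (1%:M - plane i j) r s * z s 0.
  by have := mulmxBl 1%:M (plane i j) z; rewrite Pz mul1mx subr0 => {1}<-; rewrite mxE.
apply: (ideal_sum (is_ideal_mpow _ _)) => s _.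
rewrite -add1n; apply: ideal_powM; last exact: hz.
apply: mpow1.
have -> : resB ((1%:M - plane i j) r s) = (map_mx resB (1%:M - plane i j)) r s.
  by rewrite [RHS]mxE.
rewrite map_mxB map_mx1 res_plane // !mxE.
move: rij; rewrite !inE => /orP[]/eqP->; rewrite eqxx andTb.
  by rewrite (negbTE ij) andFb addr0 eq_sym subrr.
by rewrite (eq_sym j i) (negbTE ij) andFb add0r eq_sym subrr.
Qed.

(** The vector f = P_ij x lies in V_ij. For a suitable x, the obstruction z = (1 - P_il) f to lying
    in V_il is shown, row by row, to be in every m^N. *)
Lemma plane_line i j l : i != j -> i != l -> j != l ->
  exists f : 'cV[B]_n, [/\ map_mx resB f = delta_mx i 0,
    plane i j *m f = f & plane i l *m f = f].
Proof.
move=> ij il jl; pose M := (1%:M - plane i l) *m plane i j.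
have resM r s : resB (M r s) = ((1%:M - plane_mx i l) *m plane_mx i j) r s.
  by rewrite -(res_plane ij) -(res_plane il) -(map_mx1 resB) -map_mxB -map_mxM [RHS]mxE.
have MbarE : (1%:M - plane_mx i l) *m plane_mx i j = delta_mx j j :> 'M[k]_n.
  rewrite mulmxBl mul1mx /plane_mx !mulmxDl !mulmxDr !mul_delta_mx_cond !eqxx.
  rewrite (negbTE ij) (eq_sym l i) (negbTE il) (eq_sym l j) (negbTE jl).
  by rewrite !mulr0n !mulr1n !addr0 addrC addKr.
have Mjj : M j j \is a GRing.unit.
  by rewrite cnl_unitE resM MbarE mxE !eqxx oner_neq0.
(* M reduces to the matrix unit at (j, j), so [M j j] is a unit; the multiple of e_j is chosen to
   make entry j of M x zero. *)
pose x : 'cV[B]_n := delta_mx i 0 - (M j j)^-1 * M j i *: delta_mx j 0.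
have resx : map_mx resB x = delta_mx i 0.
  have Mji : resB (M j i) = 0 by rewrite resM MbarE mxE (negbTE ij) andbF.
  by rewrite /x map_mxB map_mxZ !map_delta_mx rmorphM Mji mulr0 scale0r subr0.
pose f := plane i j *m x; pose z := (1%:M - plane i l) *m f.
have zM : z = M *m x by rewrite /z /f mulmxA.
have col_mul s : (M *m (delta_mx s 0 : 'cV_n)) j 0 = M j s.
  by rewrite -colE mxE.
have zj : z j 0 = 0.
  rewrite zM /x mulmxBr -scalemxAr mxE [X in _ + X]mxE [X in - X]mxE !col_mul.
  by rewrite mulrAC mulVr // mul1r subrr.
have Pilz : plane i l *m z = 0.
  by rewrite /z mulmxA (mulmxBr (plane i l) 1%:M (plane i l)) mulmx1 plane_idem // subrr mul0mx.
have hz N r : mpow N (z r 0).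
  case: N => [|N]; first exact: ideal_pow0.
  elim: N r => [|N ih] r.
    apply: mpow1.
    have -> : resB (z r 0) = (map_mx resB z) r 0 by rewrite [RHS]mxE.
    rewrite /z /f !map_mxM resx map_mxB map_mx1 !res_plane // mulmxA MbarE.
    by rewrite mul_delta_mx_cond (negbTE (_ : j != i)) 1?eq_sym // mxE.
  have [->|rj] := eqVneq r j; first by rewrite zj; exact: (ideal0 (is_ideal_mpow _ _)).
  have [ril|ril] := boolP (r \in [:: i; l]); first exact: (plane_entry il ril).
  move: ril; rewrite !inE negb_or => /andP[ri rl].
  (* For a row r outside {i, j, l}, the plane of r and a fifth index s is disjoint from both given
     planes, so its projection kills z. *)
  have [s] := @ord_avoid n [:: i; j; l; r] n5.
  rewrite !inE !negb_or => /and4P[si sj sl sr].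
  have rs : r != s by rewrite eq_sym.
  apply: (plane_entry rs) => //; first by rewrite inE eqxx.
  have awl : away i l r s by apply/and4P.
  have awj : away i j r s by apply/and4P.
  have MP : plane r s *m M = 0.
    rewrite /M mulmxA (mulmxBr (plane r s) 1%:M (plane i l)) mulmx1 (plane_plane il rs awl) subr0.
    exact: plane_plane.
  by rewrite zM mulmxA MP mul0mx.
have z0 : z = 0 by apply/matrixP => r s; rewrite ord1 [RHS]mxE; apply: mpow_sep => N; exact: hz.
exists f; split.
- rewrite /f map_mxM resx res_plane // /plane_mx mulmxDl !mul_delta_mx_cond.
  by rewrite eqxx (eq_sym j) (negbTE ij) mulr0n addr0.
- by rewrite /f mulmxA plane_idem.
by move: z0; rewrite /z mulmxBl mul1mx => /subr0_eq.
Qed.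

(** Take f in the intersection of V_ij and V_it. If l and m both avoid j, or both avoid t, then
    [Phi_plane] applies. *)
Lemma fixed_vector i : exists f : 'cV[B]_n, map_mx resB f = delta_mx i 0 /\
  forall l m a, l != m -> l != i -> m != i -> Phi l m a *m f = f.
Proof.
have [j] := @ord_avoid n [:: i] (ltn_trans (isT : 1 < 4)%N n5).
rewrite inE => ji; have ij : i != j by rewrite eq_sym.
have [t] := @ord_avoid n [:: i; j] (ltn_trans (isT : 2 < 4)%N n5).
rewrite !inE negb_or => /andP[ti tj].
have it : i != t by rewrite eq_sym.
have jt : j != t by rewrite eq_sym.
have [f [rf Pj Pt]] := plane_line ij it jt.
exists f; split=> //.
have fixj l m a : l != m -> away i j l m -> Phi l m a *m f = f.
  by move=> lm aw; rewrite -Pj mulmxA Phi_plane.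
have fixt l m a : l != m -> away i t l m -> Phi l m a *m f = f.
  by move=> lm aw; rewrite -Pt mulmxA Phi_plane.
have fix_jt l m a : l != m -> l != i -> m != i -> (l != j) && (m != j) ||
    (l != t) && (m != t) -> Phi l m a *m f = f.
  move=> lm li mi /orP[/andP[lj mj]|/andP[lt mt]].
    by apply: fixj => //; apply/and4P.
  by apply: fixt => //; apply/and4P.
move=> l m a lm li mi.
have [h|h] := boolP ((l != j) && (m != j) || (l != t) && (m != t)); first exact: fix_jt.
have jlt : (l == j) && (m == t) || (l == t) && (m == j).
  move: h lm li mi; rewrite negb_or !negb_and !negbK.
  case: (eqVneq l j) => [->|_]; case: (eqVneq m j) => [->|_];
    rewrite ?eqxx ?(negbTE jt) ?orbT ?andbT ?orbF ?andbF //=.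
(* The remaining case is {l, m} = {j, t}: E_lm(a) is the commutator of E_lr(a) and E_rm(1), each of
   which avoids j or t. *)
have [r] := @ord_avoid n [:: i; j; t] (ltn_trans (isT : 3 < 4)%N n5).
rewrite !inE !negb_or => /and3P[ri rj rt].
have lr : l != r.
  by rewrite eq_sym; case/orP: jlt => /andP[/eqP-> _].
have rm : r != m.
  by case/orP: jlt => /andP[_ /eqP->].
have f1 : Phi l r a *m f = f.
  apply: fix_jt => //.
  by case/orP: jlt => /andP[/eqP-> _]; rewrite ?jt ?rt ?rj ?tj ?orbT.
have f2 : Phi r m 1 *m f = f.
  apply: fix_jt => //.
  by case/orP: jlt => /andP[_ /eqP->]; rewrite ?jt ?rt ?rj ?tj ?orbT.
have := congr1 (mulmx^~ f) (es_commutator esPhi a 1 lr rm lm).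
by rewrite /= mulr1 -!mulmxA f2 !f1 f2.
Qed.

(** The fixed vectors f_s are the columns of X. This puts the conjugated system under the hypothesis
    of [es_columns]. *)
Lemma fixing_basis : exists X : 'M[B]_n, map_mx resB X = 1%:M /\
  forall i j a r s, i != j -> s != i -> s != j ->
    (invmx X *m Phi i j a *m X) r s = (r == s)%:R.
Proof.
have [f fP] := choice fixed_vector.
pose X : 'M[B]_n := \matrix_(r, s) f s r 0.
have colX s : X *m (delta_mx s 0 : 'cV_n) = f s.
  by rewrite -colE; apply/matrixP => r c; rewrite ord1 !mxE.
have X1 : map_mx resB X = 1%:M.
  apply/matrixP => r s; rewrite !mxE.
  have [/matrixP/(_ r 0)] := fP s.
  by rewrite !mxE eqxx andbT => -> _.
exists X; split=> // i j a r s ij si sj.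
have Xu := res_det X1.
have -> : (invmx X *m Phi i j a *m X) r s =
    (invmx X *m Phi i j a *m X *m (delta_mx s 0 : 'cV_n)) r 0.
  by rewrite -colE [RHS]mxE.
rewrite -mulmxA colX -mulmxA.
have is' : i != s by rewrite eq_sym.
have js' : j != s by rewrite eq_sym.
have [_ fixs] := fP s; rewrite fixs //.
by rewrite -colX mulmxA mulVmx // mul1mx mxE eqxx andbT.
Qed.

End Fixing.

(** * Normal forms of lifts *)

Section ElementarySL.
Variables (n : nat) (R : comUnitRingType).

(** The identity is the default of [insubd], reached for i = j when the determinant is not 1; the
    intended value is for i <> j. *)
Definition SLelem (i j : 'I_n) (a : R) : SL n R := insubd (SL_one n R) (elem i j a).

Lemma SLelemE i j a : i != j -> SLval (SLelem i j a) = elem i j a.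
Proof. by move=> ij; rewrite [LHS]insubdK //; apply/eqP; exact: det_elem. Qed.

End ElementarySL.

Section RepresentationSystem.
Variables (p : nat) (p_pr : prime p) (k : finFieldType) (A B : cnlRing p_pr k).
Variable n : nat.
Local Notation resA := (@cnl_res _ _ _ A).
Local Notation resB := (@cnl_res _ _ _ B).
Variable rho : topSL n A -> 'M[B]_n.
Hypothesis rho_rep : is_representation rho.
Hypothesis rho_res : forall g, map_mx resB (rho g) = residual_rep n A g.

Definition rho_elem i j a := rho (SLelem i j a : topSL n A).

Lemma rhoM (g h x : topSL n A) : SLval g *m SLval h = SLval x -> rho g *m rho h = rho x.
Proof. by case: rho_rep => _ _ rM e; rewrite -rM; congr rho; apply/val_inj. Qed.

Lemma rho1 (g : topSL n A) : SLval g = 1%:M -> rho g = 1%:M.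
Proof. by case: rho_rep => _ <- _ e; congr rho; apply/val_inj. Qed.

Lemma rhoME (g h : topSL n A) : rho g *m rho h = rho (SL_mul g h).
Proof. exact: rhoM. Qed.

Lemma rho_elementary_system : elementary_system rho_elem.
Proof.
split=> [i j l m a b ij lm jl im|i j a b ij|i j l a b ij jl il|i j a ij].
- rewrite /rho_elem !rhoME; congr rho; apply/val_inj => /=.
  by rewrite !SLelemE // elem_comm.
- by rewrite /rho_elem !rhoME; congr rho; apply/val_inj; rewrite /= !SLelemE // elemD.
- rewrite /rho_elem !rhoME; congr rho; apply/val_inj => /=.
  by rewrite !SLelemE // elem_commutator.
by rewrite rho_res /residual_rep /std_rep SLelemE // map_elem.
Qed.

End RepresentationSystem.

(** * Averaging over a finite group of order invertible in k *)

Section Average.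
Variables (p : nat) (p_pr : prime p) (k : finFieldType) (B : cnlRing p_pr k).
Variables (n : nat) (H : finGroupType).
Local Notation resB := (@cnl_res _ _ _ B).
Variables r1 r2 : H -> 'M[B]_n.
Hypotheses (r1M : {morph r1 : g h / (g * h)%g >-> g *m h}).
Hypotheses (r2M : {morph r2 : g h / (g * h)%g >-> g *m h}) (r21 : r2 1%g = 1%:M).
Hypothesis r12 : forall h, map_mx resB (r1 h) = map_mx resB (r2 h).
Hypothesis Hunit : (#|H|%:R : k) != 0.

(** The average of r1(h) r2(h)^-1 intertwines by reindexing the sum, and each of its terms reduces
    to 1. *)
Lemma average_conj : exists X : 'M[B]_n, map_mx resB X = 1%:M /\
  forall h, r1 h *m X = X *m r2 h.
Proof.
have cu : (#|H|%:R : B) \is a GRing.unit by rewrite cnl_unitE rmorph_nat.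
exists (#|H|%:R^-1 *: \sum_h r1 h *m r2 h^-1%g); split.
  rewrite map_mxZ raddf_sum (eq_bigr (fun=> 1%:M)); last first.
    by move=> h _; rewrite /= map_mxM r12 -map_mxM -r2M mulgV r21 map_mx1.
  by rewrite sumr_const -[1%:M *+ _]scaler_nat scalerA rmorphV // rmorph_nat mulVf ?scale1r.
move=> g; rewrite -scalemxAr -scalemxAl; congr (_ *: _).
rewrite mulmx_sumr mulmx_suml [RHS](reindex_inj (mulgI g)) /=.
apply: eq_bigr => h _; rewrite r1M -!mulmxA; congr (_ *m (_ *m _)).
by rewrite -r2M invMg -mulgA mulVg mulg1.
Qed.

End Average.

Lemma card_finField_natr (k : finFieldType) : #|k|%:R = 0 :> k.
Proof. by rewrite -FinRing.zmodXgE -cardsT; rewrite expg_cardG ?finset.in_setT. Qed.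

(** * The finite torus of diagonal Teichmueller matrices *)

Section Torus.
Variables (p : nat) (p_pr : prime p) (k : finFieldType).
Variable n : nat.
Local Notation H := ({dffun 'I_n * 'I_n -> {unit k}} : finGroupType).

(** The order is a power of #|k| - 1, which is -1 in k. *)
Lemma card_torus_neq0 : (#|H|%:R : k) != 0.
Proof.
have -> : #|H| = (#|k|.-1 ^ #|{: 'I_n * 'I_n}|)%N.
  by rewrite -card_finField_unit cardsT -card_ffun.
rewrite natrX expf_neq0 //; apply: contra_neq (@oner_neq0 k) => h.
have := card_finField_natr k; rewrite -(prednK (_ : 0 < #|k|)%N).
  by rewrite mulrSr h add0r.
by apply/card_gt0P; exists 0.
Qed.

(* The product over the pairs [(i, j)] of the values at [e (i, j)] of the coroots. *)
Definition torus_char (e : H) (l : 'I_n) : k :=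
  \prod_j (val (e (l, j)) / val (e (j, l))).

Lemma torus_charM e f l : torus_char (e * f)%g l = torus_char e l * torus_char f l.
Proof.
rewrite /torus_char -big_split; apply: eq_bigr => j _ /=.
by rewrite !mulg_ffun /= invfM mulrACA.
Qed.

Lemma torus_char1 l : torus_char 1%g l = 1.
Proof. by apply: big1 => j _; rewrite !oneg_ffun /= divr1. Qed.

Lemma prod_torus_char e : \prod_l torus_char e l = 1.
Proof.
rewrite /torus_char.
under eq_bigr do rewrite big_split /=.
rewrite big_split /= [X in _ * X]exchange_big /= -big_split /= big1 // => i _.
rewrite -big_split big1 //= => j _.
by rewrite divff // -unitfE; exact: valP.
Qed.

Lemma torus_char_neq0 e l : torus_char e l != 0.
Proof.
apply/prodf_neq0 => j _; rewrite mulf_neq0 ?invr_eq0 // -unitfE; exact: valP.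
Qed.

Lemma torus_char_pair (x : k) i j l : x != 0 -> i != j -> l != i -> l != j ->
  exists e, torus_char e i = x /\ torus_char e j = 1.
Proof.
move=> x0 ij li lj; have xu : x \is a GRing.unit by rewrite unitfE.
(* Supported at the pair (i, l), [e] puts x at i and its inverse at l, away from j. *)
pose e : H := [ffun ab => if ab == (i, l) then FinRing.unit k xu else 1%g].
exists e; rewrite /torus_char; split.
  rewrite (bigD1 l) //= !ffunE eqxx xpair_eqE (negbTE li) /= divr1 big1 ?mulr1 //.
  move=> r rl; rewrite !ffunE !xpair_eqE eqxx (negbTE rl) /=.
  by rewrite (eq_sym i l) (negbTE li) andbF /= divr1.
apply: big1 => r _; rewrite !ffunE !xpair_eqE eq_sym (negbTE ij) /=.
by rewrite (eq_sym j l) (negbTE lj) andbF /= divr1.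
Qed.

Section TorusIn.
Variable A : cnlRing p_pr k.
Local Notation resA := (@cnl_res _ _ _ A).

Definition teich (x : k) : A := (teichmuller p_pr x)%:A.

Lemma teichM x y : teich (x * y) = teich x * teich y.
Proof. by rewrite /teich teichmullerM -[_%:A]/(in_alg A _) rmorphM. Qed.

Lemma teich1 : teich 1 = 1.
Proof. by rewrite /teich teichmuller1 scale1r. Qed.

Lemma res_teich x : resA (teich x) = x.
Proof. by rewrite cnl_res_scalar. Qed.

Lemma teich_unit x : x != 0 -> teich x \is a GRing.unit.
Proof. by move=> x0; rewrite cnl_unitE res_teich. Qed.

Definition torus_mx (e : H) : 'M[A]_n := diag_mx (\row_l teich (torus_char e l)).

Lemma torus_mxM e f : torus_mx (e * f)%g = torus_mx e *m torus_mx f.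
Proof.
rewrite mulmx_diag; congr diag_mx; apply/rowP => l.
by rewrite !mxE torus_charM teichM.
Qed.

Lemma torus_mx1 : torus_mx 1%g = 1%:M.
Proof.
rewrite -diag_const_mx; congr diag_mx; apply/rowP => l.
by rewrite !mxE torus_char1 teich1.
Qed.

Lemma det_torus_mx e : \det (torus_mx e) = 1.
Proof.
rewrite det_diag (eq_bigr (fun l => teich (torus_char e l))) => [|l _]; last by rewrite mxE.
by rewrite -(big_morph teich teichM teich1) prod_torus_char teich1.
Qed.

Lemma res_torus_mx e : map_mx resA (torus_mx e) = diag_mx (\row_l torus_char e l).
Proof.
rewrite map_diag_mx; congr diag_mx; apply/rowP => l.
by rewrite !mxE res_teich.
Qed.

Definition SLtorus (e : H) : SL n A := insubd (SL_one n A) (torus_mx e).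

Lemma SLtorusE e : SLval (SLtorus e) = torus_mx e.
Proof. by rewrite [LHS]insubdK //; apply/eqP; exact: det_torus_mx. Qed.

Lemma torus_elem e (i j : 'I_n) a : torus_mx e *m elem i j a =
  elem i j (teich (torus_char e i) / teich (torus_char e j) * a) *m torus_mx e.
Proof.
apply/matrixP => r s; rewrite mul_diag_mx mul_mx_diag !mxE !elemE.
have cu := teich_unit (torus_char_neq0 e j).
have [->|ri] := eqVneq r i; have [->|sj] := eqVneq s j; rewrite /= ?mulr0 ?addr0 ?mulr1.
- rewrite mulrDr mulrDl; congr (_ + _).
    by have [->|] := eqVneq i j; rewrite ?mulr0 ?mul0r // mulrC.
  by rewrite mulrAC divrK.
- by have [->|] := eqVneq i s; rewrite ?mulr0 ?mul0r // mulrC.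
- by have [->|] := eqVneq r j; rewrite ?mulr0 ?mul0r // mulrC.
by have [->|] := eqVneq r s; rewrite ?mulr0 ?mul0r // mulrC.
Qed.

End TorusIn.

Variables (A B : cnlRing p_pr k).
Local Notation resA := (@cnl_res _ _ _ A).
Local Notation resB := (@cnl_res _ _ _ B).
Variable rho : topSL n A -> 'M[B]_n.
Hypothesis rho_rep : is_representation rho.
Hypothesis rho_res : forall g, map_mx resB (rho g) = residual_rep n A g.

(** Averaging turns the image of the torus into Teichmueller diagonal matrices over B. Conjugation
    by a diagonal matrix preserves diagonal entries, whence the invariance under a -> ta that
    [es_torus] requires. *)
Lemma torus_normal_form : (2 < n)%N -> #|k| != 2%N -> exists X : 'M[B]_n,
  map_mx resB X = 1%:M /\
  let Phi i j a := invmx X *m rho_elem rho i j a *m X in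
  forall i j a, i != j -> Phi i j a = elem i j (Phi i j a i j).
Proof.
move=> n3 k2.
pose r1 e := rho (SLtorus A e : topSL n A).
have [||X [X1 XP]] :=
  @average_conj _ _ _ B n H r1 (torus_mx B) _ (torus_mxM B) (torus_mx1 B) _ card_torus_neq0.
- by move=> e f; rewrite /r1 rhoME //; congr rho; apply/val_inj; rewrite /= !SLtorusE torus_mxM.
- by move=> e; rewrite rho_res /residual_rep /std_rep SLtorusE !res_torus_mx.
exists X; split=> //=.
have Xu := res_det X1.
have esPhi := es_conj X1 (rho_elementary_system rho_rep rho_res).
apply: (es_torus esPhi n3) => i j ij.
have [l li lj] : exists2 l : 'I_n, l != i & l != j.
  by have [l] := @ord_avoid n [:: i; j] n3; rewrite !inE negb_or => /andP[]; exists l.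
(* Since #|k| <> 2 there is an x other than 0 and 1; its Teichmueller lift t then has t - 1
   invertible. *)
have [x x0 x1] : exists2 x : k, x != 0 & x != 1.
  pose S : {set k} := [set 0; 1]%SET.
  have S2 : #|S| = 2 by rewrite cards2 eq_sym oner_neq0.
  have : (0 < #|~: S|)%N.
    rewrite cardsCs finset.setCK S2 subn_gt0 ltn_neqAle eq_sym k2 /= -S2.
    exact: max_card.
  by case/card_gt0P => x; rewrite !inE negb_or => /andP[]; exists x.
have [e [ei ej]] := torus_char_pair x0 ij li lj.
exists (teich A x); first by rewrite cnl_unitE rmorphB res_teich rmorph1 subr_eq0.
move=> a r.
(* The torus element with characters x at i and 1 at j conjugates E_ij(a) to E_ij(ta). *)
have key : torus_mx B e *m (invmx X *m rho_elem rho i j a *m X) =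
   (invmx X *m rho_elem rho i j (teich A x * a) *m X) *m torus_mx B e.
  have XP' : torus_mx B e *m invmx X = invmx X *m r1 e.
    by rewrite -[LHS](mulKmx Xu) [X *m (_ *m _)]mulmxA -XP mulmxK.
  rewrite -[RHS]mulmxA -XP !mulmxA XP'; congr (_ *m X); rewrite -!mulmxA; congr (_ *m _).
  rewrite /r1 /rho_elem !rhoME //; congr rho.
  by apply/val_inj; rewrite /= !SLelemE // SLtorusE torus_elem ei ej teich1 divr1.
have := congr1 (fun M : 'M[B]_n => M r r) key.
rewrite mul_diag_mx mul_mx_diag [LHS]mxE [RHS]mxE !mxE [RHS]mulrC.
move=> /(mulrI (teich_unit B (torus_char_neq0 e r))) h; symmetry; exact: h.
Qed.

End Torus.

(** * Existence and uniqueness of the morphism A -> B *)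

Section Existence.
Variables (p : nat) (p_pr : prime p) (k : finFieldType).
Hypothesis charkp : p \in [pchar k].
Variable n : nat.
Variables (A B : cnlRing p_pr k).
Local Notation resA := (@cnl_res _ _ _ A).
Local Notation resB := (@cnl_res _ _ _ B).
Variable rho : topSL n A -> 'M[B]_n.
Hypothesis rho_rep : is_representation rho.
Hypothesis rho_res : forall g, map_mx resB (rho g) = residual_rep n A g.

(** Since 2 = 0 in k, 3 is nonzero there, and the images of [rot3] supply the matrices of cube 1
    that [fixing_basis] requires. *)
Lemma fixing_normal_form : (4 < n)%N -> #|k| = 2%N -> exists X : 'M[B]_n,
  map_mx resB X = 1%:M /\
  let Phi i j a := invmx X *m rho_elem rho i j a *m X in
  forall i j a, i != j -> Phi i j a = elem i j (Phi i j a i j).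
Proof.
move=> n5 k2.
have es := rho_elementary_system rho_rep rho_res.
have k3 : (3 : k) != 0.
  have := card_finField_natr k; rewrite k2 => two0.
  by rewrite mulrSr two0 add0r oner_neq0.
have rotation_cube i j : i != j ->
    rotation (rho_elem rho) i j *m rotation (rho_elem rho) i j *m rotation (rho_elem rho) i j = 1%:M.
  move=> ij; rewrite /rotation /rho_elem !rhoME //; apply: rho1 => //=.
  have ji : j != i by rewrite eq_sym.
  by rewrite !SLelemE //; exact: rot3_cube.
have [X [X1 XP]] := fixing_basis es rotation_cube k3 n5.
exists X; split=> //=.
apply: (es_columns (es_conj X1 es)); first exact: ltn_trans n5.
exact: XP.
Qed.

(** Induction on an elementary word for g, peeling off its first letter. *)
Lemma intertwine_elementary (pi : {rmorphism A -> B}) (Y : 'M[B]_n) :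
  (forall i j a, i != j -> Y *m rho_elem rho i j a = elem i j (pi a) *m Y) ->
  forall g, Y *m rho g = map_mx pi (std_rep n A g) *m Y.
Proof.
move=> hY g; rewrite /std_rep.
have [w] := SL_elementary (@cnl_unit_sum _ _ _ A) (det_SL g).
elim: w g => [|[[i j] a] w ih] g /=.
  by move=> _ e; rewrite e map_mx1 mul1mx (rho1 rho_rep e) mulmx1.
case/andP=> /= ij wf e.
have e' : SLval (SL_mul (SLelem i j (- a)) g) = elem_word w.
  by rewrite /= SLelemE // e mulmxA elemNK // mul1mx.
have -> : rho g = rho_elem rho i j a *m rho (SL_mul (SLelem i j (- a)) g).
  rewrite /rho_elem rhoME //; congr rho; apply/val_inj => /=.
  by rewrite !SLelemE // mulmxA -elemD // subrr elem0 mul1mx.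
by rewrite mulmxA hY // -mulmxA ih // e' e map_mxM map_elem mulmxA.
Qed.

Lemma lift_strictly_equivalent : (2 < n)%N -> (#|k| = 2%N -> (4 < n)%N) ->
  exists pi : {lrmorphism A -> B}, (forall a, resB (pi a) = resA a) /\
    strictly_equivalent (fun g => map_mx pi (std_rep n A g)) rho.
Proof.
move=> n3 nk.
have [X [X1 XP]] : exists X : 'M[B]_n, map_mx resB X = 1%:M /\
  let Phi i j a := invmx X *m rho_elem rho i j a *m X in
  forall i j a, i != j -> Phi i j a = elem i j (Phi i j a i j).
  have [k2|k2] := eqVneq #|k| 2%N.
    by apply: fixing_normal_form => //; exact: nk.
  exact: torus_normal_form.
have Xu := res_det X1.
have es := es_conj X1 (rho_elementary_system rho_rep rho_res).
have [v [f [rv rf [f1 fD fM] fP]]] := elementary_form_morphism es n3 XP.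
have [pi piE] := cnl_lrmorphism charkp rf f1 fD fM.
exists pi; split; first by move=> a; rewrite piE.
(* After conjugation by X the matrices are E_ij(v_i^-1 f(a) v_j); conjugating by D removes the
   factors v. *)
pose D : 'M[B]_n := diag_mx (\row_i v i).
have D1 : map_mx resB D = 1%:M.
  rewrite map_diag_mx -diag_const_mx; congr diag_mx; apply/rowP => i.
  by rewrite !mxE rv.
pose Y := D *m invmx X.
have Y1 : map_mx resB Y = 1%:M by rewrite map_mxM D1 res_invmx // mulmx1.
have Yu := res_det Y1.
exists Y; split=> // g.
rewrite -mulmxA -intertwine_elementary ?mulKmx // => i j a ij.
have vu l : v l \is a GRing.unit by rewrite cnl_unitE rv oner_neq0.
have DE c : D *m elem i j ((v i)^-1 * c * v j) = elem i j c *m D.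
  apply/matrixP => r s; rewrite mul_diag_mx mul_mx_diag !mxE !elemE.
  rewrite mulrDr mulrDl; congr (_ + _).
    by have [->|] := eqVneq r s; rewrite ?mulr0 ?mul0r // mulrC.
  have [->|_] := eqVneq r i; last by rewrite !mulr0 mul0r.
  have [->|_] := eqVneq s j; last by rewrite !mulr0 mul0r.
  by rewrite /= !mulr1 !mulrA divrr // mul1r.
rewrite -[RHS]/(elem i j (pi a) *m Y) piE [RHS]mulmxA -DE -fP // /Y !mulmxA.
by rewrite mulmxK.
Qed.

(** With Z = X Y^-1, the entry (i, j) of Z E_ij(pi' a) = E_ij(pi a) Z gives pi'(a) Z_ii = pi(a)
    Z_jj. At a = 1 this reads Z_ii = Z_jj, a unit because Z reduces to 1. *)
Lemma strict_equivalence_unique (pi pi' : {rmorphism A -> B}) : (1 < n)%N ->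
  strictly_equivalent (fun g => map_mx pi (std_rep n A g)) rho ->
  strictly_equivalent (fun g => map_mx pi' (std_rep n A g)) rho -> pi' =1 pi.
Proof.
move=> n2 [X [Xu X1 XP]] [Y [Yu Y1 YP]].
pose Z := X *m invmx Y.
have ZP i j a : i != j -> Z *m elem i j (pi' a) = elem i j (pi a) *m Z.
  move=> ij; have := XP (SLelem i j a); rewrite YP /std_rep SLelemE // !map_elem.
  move=> /(congr1 (fun M => X *m M *m invmx Y)).
  by rewrite !mulmxA mulmxV // mul1mx mulmxK // /Z mulmxA.
pose i : 'I_n := Ordinal (ltn_trans (isT : 0 < 1)%N n2).
pose j : 'I_n := Ordinal n2.
have ij : i != j by [].
have ZE a : pi' a * Z i i = pi a * Z j j.
  have /matrixP/(_ i j) := ZP i j a ij.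
  rewrite !elem_def mulmxDr mulmxDl mulmx1 mul1mx -scalemxAr -scalemxAl.
  have mxD (M N : 'M[B]_n) : (M + N) i j = M i j + N i j by rewrite mxE.
  have mxZ d (M : 'M[B]_n) : (d *: M) i j = d * M i j by rewrite mxE.
  by rewrite !mxD !mxZ mul_mx_deltaE mul_delta_mxE !eqxx !mul1r => /addrI.
have Zij : Z i i = Z j j by have := ZE 1; rewrite !rmorph1 !mul1r.
have Zu : Z j j \is a GRing.unit.
  rewrite cnl_unitE; have -> : resB (Z j j) = (map_mx resB Z) j j by rewrite [RHS]mxE.
  by rewrite map_mxM X1 res_invmx // mulmx1 mxE eqxx oner_neq0.
by move=> a; have := ZE a; rewrite Zij => /(mulIr Zu).
Qed.

End Existence.

(** * Topology of the special linear group *)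

Local Open Scope classical_set_scope.

Lemma ideal_gen_seq (R : comNzRingType) (s : seq R) x : ideal_gen [set` s] x ->
  exists c : 'I_(size s) -> R, x = \sum_i c i * s`_i.
Proof.
suff h : ideal_gen [set` s] `<=`
  [set x | exists c : 'I_(size s) -> R, x = \sum_i c i * s`_i] by exact: h.
apply: smallest_sub.
  split=> [|_ _ [c ->] [d ->]|a _ [c ->]].
  - by exists (fun=> 0); rewrite big1 // => i _; rewrite mul0r.
  - exists (fun i => c i + d i); rewrite -big_split.
    by apply: eq_bigr => i _; rewrite /= mulrDl.
  - exists (fun i => a * c i); rewrite mulr_sumr.
    by apply: eq_bigr => i _; rewrite mulrA.
move=> y /= ys; have iy : (index y s < size s)%N by rewrite index_mem.
exists (fun i => (i == Ordinal iy)%:R); rewrite (bigD1 (Ordinal iy)) //= eqxx mul1r.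
rewrite nth_index // big1 ?addr0 // => i /negbTE->.
by rewrite mul0r.
Qed.

Section Congruences.
Variables (R : comNzRingType) (I : set R).
Hypothesis idI : is_ideal I.

Lemma ideal_prodB (T : Type) (r : seq T) (x y : T -> R) :
  (forall i, I (x i - y i)) -> I (\prod_(i <- r) x i - \prod_(i <- r) y i).
Proof.
move=> h; elim: r => [|i r ih]; first by rewrite !big_nil subrr; exact: (ideal0 idI).
rewrite !big_cons; have -> : x i * \prod_(j <- r) x j - y i * \prod_(j <- r) y j =
  x i * (\prod_(j <- r) x j - \prod_(j <- r) y j) + (\prod_(j <- r) y j) * (x i - y i).
  by ring.
by apply: (idealD idI); apply: (idealM idI).
Qed.

Definition mx_in m n (M : 'M[R]_(m, n)) := forall i j, I (M i j).

Lemma mx_in_mull m n q (M : 'M[R]_(m, n)) (N : 'M[R]_(n, q)) : mx_in N -> mx_in (M *m N).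
Proof. by move=> h i j; rewrite mxE; apply: (ideal_sum idI) => l _; apply: (idealM idI). Qed.

Lemma mx_in_mulr m n q (M : 'M[R]_(m, n)) (N : 'M[R]_(n, q)) : mx_in M -> mx_in (M *m N).
Proof. by move=> h i j; rewrite mxE; apply: (ideal_sum idI) => l _; apply: (ideal_mulr idI). Qed.

Lemma mx_inD m n (M N : 'M[R]_(m, n)) : mx_in M -> mx_in N -> mx_in (M + N).
Proof. by move=> hM hN i j; rewrite mxE; apply: (idealD idI). Qed.

Lemma mx_inN m n (M : 'M[R]_(m, n)) : mx_in M -> mx_in (- M).
Proof. by move=> hM i j; rewrite mxE; apply: (idealN idI). Qed.

Lemma ideal_detB n (M N : 'M[R]_n) : mx_in (M - N) -> I (\det M - \det N).
Proof.
move=> h; rewrite /determinant -sumrB; apply: (ideal_sum idI) => s _.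
rewrite -mulrBr; apply: (idealM idI); apply: ideal_prodB => i.
by have := h i (s i); rewrite !mxE.
Qed.

End Congruences.

Section Topology.
Variables (p : nat) (p_pr : prime p) (k : finFieldType) (A : cnlRing p_pr k).
Local Notation res := (@cnl_res _ _ _ A).

Lemma nbhs_mx_madic n (M : 'M[madic A]_n) (U : set 'M[madic A]_n) :
  nbhs M U <-> exists N, [set M' : 'M[madic A]_n |
    mx_in (mpow N) ((M' : 'M[A]_n) - (M : 'M[A]_n))] `<=` U.
Proof.
split=> [[P hP sub]|[N sub]].
  have /choice[N NP] : forall ij : 'I_n * 'I_n, exists N : nat,
      forall y : A, mpow N (y - (M ij.1 ij.2 : A)) -> P ij.1 ij.2 y.
    by move=> [i j]; have [N _ h] := hP i j; exists N => y; exact: h.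
  exists (\max_ij N ij)%N => M' hM'; apply: sub => i j.
  apply: (NP (i, j)); apply: (@ideal_pow_sub _ _ _ (\max_ij N ij)%N).
    exact: (leq_bigmax (i, j)).
  by have := hM' i j; rewrite !mxE.
exists (fun i j => [set y | mpow N ((y : A) - (M i j : A))]).
  by move=> i j; exists N.
by move=> M' hM'; apply: sub => i j; rewrite !mxE; exact: hM'.
Qed.

Section TopSL.
Variable n : nat.
Local Notation G := (topSL n A).

Definition SLball (g : G) N : set G := [set h | mx_in (mpow N) (SLval h - SLval g)].

Lemma nbhs_topSL (g : G) (U : set G) : nbhs g U <-> exists N, SLball g N `<=` U.
Proof.
split=> [[B [[V oV <-] Vg] sub]|[N sub]].
  have /nbhs_mx_madic[N hN] : nbhs (SLval g : 'M[madic A]_n) V by exact: open_nbhs_nbhs.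
  by exists N => h hh; apply: sub; apply: hN.
apply: filterS sub _.
pose f := @SLval n A : SL n A -> 'M[madic A]_n.
pose V := [set M : 'M[madic A]_n | mx_in (mpow N) ((M : 'M[A]_n) - SLval g)].
have fg : nbhs (f g) V by apply/nbhs_mx_madic; exists N.
exact: (@initial_continuous _ _ f g V fg).
Qed.

Lemma SLball_refl g N : SLball g N g.
Proof. by move=> i j; rewrite subrr mxE; exact: (ideal0 (is_ideal_mpow A N)). Qed.

Lemma SLball_sym g h N : SLball g N h -> SLball h N g.
Proof. by move=> /(mx_inN (is_ideal_mpow A N)); rewrite opprB. Qed.

Lemma SLball_trans g h x N : SLball g N h -> SLball h N x -> SLball g N x.
Proof. by move=> gh hx; have := mx_inD (is_ideal_mpow A N) hx gh; rewrite addrA subrK. Qed.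

Lemma SLball_mul g h g' h' N : SLball g N g' -> SLball h N h' ->
  SLball (g * h)%g N (g' * h')%g.
Proof.
move=> hg hh; rewrite /SLball /=.
have -> : SLval g' *m SLval h' - SLval g *m SLval h =
    (SLval g' - SLval g) *m SLval h' + SLval g *m (SLval h' - SLval h).
  by rewrite mulmxBl mulmxBr addrA subrK.
have idN := is_ideal_mpow A N.
have h1 : mx_in (mpow N) ((SLval g' - SLval g) *m SLval h').
  by apply: mx_in_mulr.
have h2 := @mx_in_mull _ _ idN _ _ _ (SLval g) _ hh.
exact: (@mx_inD _ _ idN _ _ _ _ h1 h2).
Qed.

Lemma SLball_inv g g' N : SLball g N g' -> SLball (g^-1)%g N (g'^-1)%g.
Proof.
move=> hg; rewrite /SLball /=.
have -> : invmx (SLval g') - invmx (SLval g) =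
    invmx (SLval g') *m (SLval g - SLval g') *m invmx (SLval g).
  rewrite mulmxBr mulmxBl mulVmx ?SL_unitmx // mul1mx mulmxK ?SL_unitmx //.
have idN := is_ideal_mpow A N.
have h1 := @mx_in_mull _ _ idN _ _ _ (invmx (SLval g')) _ (SLball_sym hg).
exact: (@mx_in_mulr _ _ idN _ _ _ _ (invmx (SLval g)) h1).
Qed.

Lemma SLball_sep g h : (forall N, SLball g N h) -> h = g.
Proof.
move=> gh; apply/val_inj/matrixP => i j; apply/eqP; rewrite -subr_eq0; apply/eqP.
by apply: mpow_sep => N; have := gh N i j; rewrite !mxE.
Qed.

Lemma topSL_hausdorff : hausdorff_space G.
Proof.
move=> g h gh; apply/esym/SLball_sep => N.
have [] := gh (SLball g N) (SLball h N).
- by apply/nbhs_topSL; exists N.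
- by apply/nbhs_topSL; exists N.
by move=> x [gx hx]; apply: SLball_trans gx _; exact: SLball_sym.
Qed.

Lemma open_SLball g N : open (SLball g N).
Proof.
rewrite openE => h gh; apply/nbhs_topSL; exists N => x hx.
exact: SLball_trans gh hx.
Qed.

(** Congruence modulo m^N is an equivalence relation, so the complement of a ball is a union of
    balls. *)
Lemma clopen_SLball g N : clopen (SLball g N).
Proof.
split; first exact: open_SLball.
rewrite -openC openE => h gh; apply/nbhs_topSL; exists N => x hx gx.
by apply: gh; apply: SLball_trans gx _; exact: SLball_sym.
Qed.

Lemma topSL_totally_disconnected : totally_disconnected [set: G].
Proof.
apply: zero_dimension_totally_disconnected => g h gh.
have [N hN] : exists N, ~ SLball g N h.
  apply: contrapT => /forallNP hh; move: gh; rewrite (SLball_sep (g := g) (h := h)) ?eqxx //.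
  by move=> N; apply: contrapT; exact: hh.
by exists (SLball g N); split=> //; [exact: clopen_SLball|exact: SLball_refl].
Qed.

Lemma topSL_mul_continuous : continuous (fun x : G * G => (x.1 * x.2)%g).
Proof.
move=> [g h] U /nbhs_topSL[N sub].
exists (SLball g N, SLball h N) => /=.
  by split; apply/nbhs_topSL; exists N.
by move=> [g' h'] [/= hg hh]; apply: sub; exact: SLball_mul.
Qed.

Lemma topSL_inv_continuous : continuous (fun x : G => (x^-1)%g).
Proof.
move=> g U /nbhs_topSL[N sub]; apply/nbhs_topSL; exists N => h hg.
by apply: sub; exact: SLball_inv.
Qed.

Lemma std_rep_continuous : continuous (std_rep n A : G -> 'M[madic A]_n).
Proof. exact: initial_continuous. Qed.

Lemma residual_rep_continuous :
  continuous (residual_rep n A : G -> 'M[discrete_topology k]_n).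
Proof.
move=> g U /nbhs_singleton Ug; apply/nbhs_topSL; exists 1%N => h gh.
suff e : residual_rep n A h = residual_rep n A g.
  by change (U (residual_rep n A h)); rewrite e.
apply/matrixP => i j; rewrite !mxE; apply/eqP; rewrite -subr_eq0 -rmorphB; apply/eqP.
by apply: mpow1_res; have := gh i j; rewrite !mxE.
Qed.

End TopSL.
End Topology.

(** * Approximation of A by finite sets *)

Section Approximation.
Variables (p : nat) (p_pr : prime p) (k : finFieldType) (A : cnlRing p_pr k).
Local Notation res := (@cnl_res _ _ _ A).

(** Take for s the Teichmueller representatives and finitely many generators of m. Modulo m^(N+1),
    an element is its Teichmueller part plus a combination of these generators with coefficients
    known modulo m^N. [Z] is all of A when finiteness of A / m^N is wanted, and the set of a with
    all E_ij(a) in a given subgroup in [topSL_tfg]. *)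
Lemma cnl_generators : exists s : seq A, forall Z : set A,
  (forall a, a \in s -> Z a) -> Z 0 ->
  (forall a b, Z a -> Z b -> Z (a + b)) -> (forall a b, Z a -> Z b -> Z (a * b)) ->
  forall N, exists t : seq A, (forall a, a \in t -> Z a) /\
    forall a, exists2 b, b \in t & mpow N (a - b).
Proof.
have [s sE] := cnl_noetherian (is_ideal_max A).
pose l x := teich A x.
exists ([seq l x | x <- enum k] ++ s) => Z sZ Z0 ZD ZM.
have lZ x : Z (l x) by apply: sZ; rewrite mem_cat map_f ?mem_enum.
have nZ i : (i < size s)%N -> Z s`_i.
  by move=> si; apply: sZ; rewrite mem_cat mem_nth ?orbT.
elim=> [|N [t [tZ tP]]].
  exists [:: 0]; split=> [a|a]; first by rewrite inE => /eqP->.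
  by exists 0; rewrite ?inE //; exact: ideal_pow0.
pose F (xc : k * {ffun 'I_(size s) -> 'I_(size t)}) : A :=
  l xc.1 + \sum_(i < size s) t`_(xc.2 i) * s`_i.
exists [seq F xc | xc <- enum {: k * {ffun 'I_(size s) -> 'I_(size t)}}]; split.
  move=> _ /mapP[[x c] _ ->]; apply: (ZD); first exact: lZ.
  apply: (big_ind Z) => [|a b|i _]; [exact: Z0|exact: ZD|].
  apply: ZM; last exact: nZ.
  by apply: tZ; exact: mem_nth.
move=> a.
have [c cE] : exists c : 'I_(size s) -> A, a - l (res a) = \sum_i c i * s`_i.
  apply: ideal_gen_seq; rewrite -sE; apply/max_idealE.
  by rewrite rmorphB res_teich subrr.
have /choice[d dP] : forall i, exists d : 'I_(size t), mpow N (c i - t`_d).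
  move=> i; have [b bt hb] := tP (c i).
  have ib : (index b t < size t)%N by rewrite index_mem.
  by exists (Ordinal ib); rewrite /= nth_index.
exists (F (res a, [ffun i => d i])); first by rewrite map_f ?mem_enum.
rewrite /F opprD addrA cE -sumrB; apply: (ideal_sum (is_ideal_mpow A _)) => i _.
rewrite /= ffunE -mulrBl -addn1; apply: ideal_powM; first exact: dP.
apply: mpow1; apply: (proj1 (max_idealE (s`_i))).
have : max_ideal A s`_i by rewrite sE => J [_]; apply; exact: mem_nth.
by [].
Qed.

End Approximation.

(** * Compactness and topological finite generation *)

Section Compact.
Variables (p : nat) (p_pr : prime p) (k : finFieldType) (A : cnlRing p_pr k).
Variable n : nat.
Local Notation G := (topSL n A).

Lemma ultra_finite_cover (T : Type) (I : finType) (F : set_system T) (S : I -> set T) :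
  UltraFilter F -> (forall x, exists i, S i x) -> exists i, F (S i).
Proof.
move=> UF cov; apply: contrapT => /forallNP h.
have FN i : F (~` S i) by have [/h//|] := in_ultra_setVsetC (S i) UF.
have : F [set x | forall i, ~ S i x] by apply: filter_forall => i; exact: FN.
by move=> /filter_ex[x hx]; have [i /hx] := cov x.
Qed.

(** There are finitely many classes modulo m^N, so an ultrafilter contains a ball for each N. The
    centres form a Cauchy sequence, whose limit exists by completeness and has determinant 1 by
    separatedness. *)
Lemma topSL_compact : compact [set: G].
Proof.
rewrite compact_ultra => F UF _.
have [s sP] := cnl_generators A.
have FN N : exists g : G, F (SLball g N).
  have [t [_ tP]] := sP setT (fun _ _ => I) I (fun _ _ _ _ => I) (fun _ _ _ _ => I) N.
  pose S (c : {ffun 'I_n * 'I_n -> 'I_(size t)}) : set G :=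
    [set g | forall i j, mpow N (SLval g i j - t`_(c (i, j)))].
  have [c cF] : exists c, F (S c).
    apply: ultra_finite_cover => g.
    have /choice[c cP] : forall ij : 'I_n * 'I_n, exists c : 'I_(size t),
        mpow N (SLval g ij.1 ij.2 - t`_c).
      move=> [i j]; have [b bt hb] := tP (SLval g i j).
      have ib : (index b t < size t)%N by rewrite index_mem.
      by exists (Ordinal ib); rewrite /= nth_index.
    by exists [ffun ij => c ij] => i j; rewrite ffunE; exact: (cP (i, j)).
  have [g gS] := filter_ex cF; exists g; apply: filterS cF => h hS i j.
  rewrite !mxE; have := idealB (is_ideal_mpow A N) (hS i j) (gS i j).
  by rewrite opprB addrA subrK.
have [g gP] := choice FN.
have gg N : SLball (g N.+1) N (g N).
  have [h [h1 h2]] := filter_ex (filterI (gP N.+1) (gP N)).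
  apply: SLball_trans (SLball_sym h2).
  by move=> i j; apply: mpowS; exact: h1.
have [M MP] : exists M : 'M[A]_n, forall N, mx_in (mpow N) (M - SLval (g N)).
  have /choice[f fP] : forall ij : 'I_n * 'I_n, exists x : A,
      forall N, mpow N (x - SLval (g N) ij.1 ij.2).
    move=> [i j]; have [_ complete] := cnl_complete A.
    apply: (complete (fun N => SLval (g N) i j)) => N.
    by have := SLball_sym (gg N) i j; rewrite !mxE.
  exists (\matrix_(i, j) f (i, j)) => N i j; rewrite !mxE; exact: (fP (i, j)).
have detM : \det M == 1.
  rewrite -subr_eq0; apply/eqP/mpow_sep => N.
  by have := ideal_detB (is_ideal_mpow A N) (MP N); rewrite det_SL.
exists (MkSL detM); split=> // U /nbhs_topSL[N sub].
apply: filterS (gP N) => h hh; apply: sub; apply: SLball_trans hh.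
by have := mx_inN (is_ideal_mpow A N) (MP N); rewrite opprB.
Qed.

Lemma topSL_profinite : profinite_group G.
Proof.
split; [exact: topSL_mul_continuous|exact: topSL_inv_continuous|exact: topSL_compact|
  exact: topSL_hausdorff|exact: topSL_totally_disconnected].
Qed.

Hypothesis n3 : (2 < n)%N.

(** The set of a with all E_ij(a) in H is stable under sums and, by commutators through a third
    index, under products. It thus meets every class modulo m^N, and approximating each letter of an
    elementary word gives density. *)
Lemma topSL_tfg : topologically_finitely_generated G.
Proof.
have [s sP] := cnl_generators A.
pose gens : seq G := [seq SLelem ij.1 ij.2 a | ij <- enum {: 'I_n * 'I_n}, a <- s].
exists gens; set H := smallest _ _.
have [H1 HM HV] : is_subgroup H.
  split=> [K [[]]//|x y Hx Hy K KP|x Hx K KP]; have [[_ KM KV] _] := KP.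
    by apply: KM; [exact: Hx|exact: Hy].
  by apply: KV; exact: Hx.
pose Z : set A := [set a | forall i j : 'I_n, i != j -> H (SLelem i j a)].
have third i j : exists2 l : 'I_n, l != i & l != j.
  by have [l] := @ord_avoid n [:: i; j] n3; rewrite !inE negb_or => /andP[]; exists l.
have Z0 : Z 0.
  move=> i j ij; suff -> : SLelem i j 0 = 1%g :> G by [].
  by apply/val_inj; rewrite /= SLelemE // elem0.
have ZD a b : Z a -> Z b -> Z (a + b).
  move=> Za Zb i j ij.
  suff -> : SLelem i j (a + b) = (SLelem i j a * SLelem i j b)%g :> G.
    by apply: (HM); [exact: Za|exact: Zb].
  by apply/val_inj; rewrite /= !SLelemE // elemD.
have ZM a b : Z a -> Z b -> Z (a * b).
  move=> Za Zb i j ij; have [l li lj] := third i j.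
  have il : i != l by rewrite eq_sym.
  have e : (SLelem i l a * SLelem l j b)%g =
      (SLelem i j (a * b) * (SLelem l j b * SLelem i l a))%g :> G.
    by apply/val_inj; rewrite /= !SLelemE // elem_commutator.
  have -> : SLelem i j (a * b) = (SLelem i l a * SLelem l j b *
      (SLelem l j b * SLelem i l a)^-1)%g :> G by rewrite e mulgK.
  by apply: (HM); [|apply: (HV)]; apply: (HM); solve [exact: Za|exact: Zb].
have Zs a : a \in s -> Z a.
  move=> sa i j ij K [_]; apply.
  by apply/allpairsP; exists ((i, j), a); rewrite mem_enum.
move=> O [g Og] oO.
have /nbhs_topSL[N sub] : nbhs g O by exact: open_nbhs_nbhs.
have [t [tZ tP]] := sP Z Zs Z0 ZD ZM N.
suff [h Hh gh] : exists2 h, H h & SLball g N h by exists h; split=> //; exact: sub.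
have [w wf e] := SL_elementary (@cnl_unit_sum _ _ _ A) (det_SL g).
elim: w g {Og sub} wf e => [|[[i j] a] w ih] g /=.
  by move=> _ e; exists 1%g => // i j; rewrite /= e subrr mxE; exact: (ideal0 (is_ideal_mpow A N)).
case/andP=> /= ij wf e.
pose g' : G := (SLelem i j (- a) * g)%g.
have gE : g = (SLelem i j a * g')%g.
  by apply/val_inj; rewrite /= !SLelemE // mulmxA -elemD // subrr elem0 mul1mx.
have [|h Hh hP] := ih g' wf.
  by rewrite /= SLelemE // e mulmxA elemNK // mul1mx.
have [b bt ab] := tP a.
exists (SLelem i j b * h)%g; first by apply: (HM) => //; exact: tZ.
rewrite gE; apply: SLball_mul => // r c.
rewrite !SLelemE // !mxE !elemE.
have -> : (r == c)%:R + b * ((r == i) && (c == j))%:R -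
    ((r == c)%:R + a * ((r == i) && (c == j))%:R) = ((r == i) && (c == j))%:R * - (a - b).
  by ring.
by apply: (idealM (is_ideal_mpow A N)); exact: (idealN (is_ideal_mpow A N)).
Qed.

End Compact.

(** * Absolute irreducibility and universality *)

Lemma residual_abs_irreducible (p : nat) (p_pr : prime p) (k : finFieldType)
  (A : cnlRing p_pr k) n : (1 < n)%N -> absolutely_irreducible (residual_rep n A).
Proof.
move=> n2 L iota; split; first exact: ltnW.
move=> V stab.
have stabE i j v : i != j -> v \in V -> elem i j 1 *m v \in V.
  move=> ij vV; have := stab (SLelem i j 1) v vV.
  by rewrite /residual_rep /std_rep SLelemE // !map_elem !rmorph1.
have [->|V0] := eqVneq V 0%VS; [by left|right].
have [l [v vV vl]] : exists l, exists2 v, v \in V & v l 0 != 0.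
  have [v vV v0] : exists2 v, v \in V & v != 0.
    by exists (vpick V); rewrite ?memv_pick ?vpick0.
  have [l vl] : exists l, v l 0 != 0.
    apply: contrapT => /forallNP h; move/eqP: v0; apply; apply/matrixP => i j.
    by rewrite ord1 mxE; apply/eqP; move/negP: (h i); rewrite negbK.
  by exists l, v.
(* E_ij(1) - 1 sends u to u_j e_i. One nonzero coordinate of a vector of V thus yields all other
   basis vectors, and one of these yields the remaining one. *)
have deltaV i j u : i != j -> u \in V -> u j 0 != 0 -> delta_mx i 0 \in V.
  move=> ij uV uj; have := memvB (stabE i j _ ij uV) uV.
  rewrite elem_def scale1r mulmxDl mul1mx addrAC subrr add0r.
  have -> : delta_mx i j *m u = u j 0 *: (delta_mx i 0 : 'cV_n).
    apply/matrixP => r s; rewrite ord1 mul_delta_mxE.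
    by rewrite !mxE eqxx andbT mulrC.
  by move=> /(memvZ (u j 0)^-1); rewrite scalerA mulVf // scale1r.
have dV i : i != l -> (delta_mx i 0 : 'cV[L]_n) \in V by move=> il; exact: (deltaV i l v).
have dVa i : (delta_mx i 0 : 'cV[L]_n) \in V.
  have [->|] := eqVneq i l; last exact: dV.
  have [j] := @ord_avoid n [:: l] n2; rewrite inE => jl.
  apply: (deltaV l j (delta_mx j 0)); [by rewrite eq_sym|exact: dV|].
  by rewrite mxE !eqxx oner_neq0.
apply/eqP; rewrite eqEsubv subvf; apply/subvP => u _.
rewrite (matrix_sum_delta u); apply: memv_suml => i _; apply: memv_suml => j _.
by rewrite ord1; apply: memvZ; exact: dVa.
Qed.

Local Close Scope classical_set_scope.

Lemma std_rep_universal (p : nat) (p_pr : prime p) (k : finFieldType)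
    (charkp : p \in [pchar k]) (A : cnlRing p_pr k) (n : nat) :
  (3 <= n)%N -> (#|k| = 2%N -> (5 <= n)%N) ->
  is_universal_deformation (residual_rep n A) (std_rep n A).
Proof.
move=> n3 nk; have n2 : (1 < n)%N by exact: ltnW.
have stdrep : is_representation (std_rep n A).
  by split=> // g; exact: SL_unitmx.
split.
- exact: topSL_profinite.
- exact: topSL_tfg.
- split=> [g||g h]; rewrite /residual_rep.
  + by rewrite unitmxE det_map_mx det_SL rmorph1 unitr1.
  + by rewrite map_mx1.
  + by rewrite -map_mxM.
- exact: residual_rep_continuous.
- exact: residual_abs_irreducible.
- by split=> //; exact: std_rep_continuous.
move=> B rho [rho_rep _ rho_res].
have [pi [piR piE]] := lift_strictly_equivalent charkp rho_rep rho_res n3 nk.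
exists pi; split=> //.
- move=> _ [a + <-]; rewrite !max_idealE => a0.
  by rewrite piR.
- by move=> pi' _ pi'E; exact: (strict_equivalence_unique n2 piE pi'E).
Qed.

Theorem mainTheorem1 (p : nat) (p_pr : prime p) (k : finFieldType)
    (charkp : p \in [pchar k]) :
  (forall A : cnlRing p_pr k, is_universal_deformation_ring A) /\
  (forall (A : cnlRing p_pr k) (n : nat),
     (3 <= n)%N -> (#|k| = 2%N -> (5 <= n)%N) ->
     is_universal_deformation (residual_rep n A) (std_rep n A)).
Proof.
split=> [A|A n n3 nk]; last exact: std_rep_universal.
(* The value n = 5 meets both bounds, whatever k is. *)
exists (topSL 5 A), 5%N, (residual_rep 5 A), (std_rep 5 A).
exact: std_rep_universal.
Qed.
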